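(* Let $G=(V,E)$ be a random geometric forest satisfying planarity, stationarity and ergodicity, and finite edge intensity (as defined in the context). Assume additionally that with probability one, $G$ is non-empty, oriented with out-degree $1$ (that is, $(v,v')\in E$ implies $(v',v)\notin E$, and every $v\in V$ has exactly one outgoing edge $(v,v')\in E$), and every directed infinite path $(\pi_n)_{n\ge0}$ in $G$ satisfies $\lim_{n\to\infty}\pi_n\cdot e_2=+\infty$, where $e_2:=(0,1)\in\mathbb R^2$ and $\cdot$ is the standard scalar product. Then exactly one of the following holds almost surely: (a) $G$ is a single one-ended tree; or (b) $G$ consists of infinitely many disjoint two-ended trees.
   Context: Let $\mathcal G$ be the set of pairs $(V,E)$ with $V\subset\mathbb R^2$ locally finite and $E\subset (V\times V)\setminus\{(v,v):v\in V\}$, endowed with the $\sigma$-field generated by the counting functions $(V,E)\mapsto\#(V\cap D)$ and $(V,E)\mapsto\#(E\cap H)$ for bounded Borel sets $D\subset\mathbb R^2$, $H\subset\mathbb R^2\times\mathbb R^2$. A random geometric forest is a measurable map $G=(V,E):(\Omega,\mathcal F,\mathbb P)\to\mathcal G$ on a probability space such that almost surely the underlying undirected graph is acyclic and every vertex has finite degree. Conditions on $G$: Planarity: (almost surely) for any two edges $(u,u'),(v,v')\in E$, the line segments $[u,u']$ and $[v,v']$, when they are distinct, can intersect only at a common endpoint. Stationarity and ergodicity: there is a measurable, measure-preserving, ergodic action $(\theta_s)_{s\in\mathbb R^2}$ of $\mathbb R^2$ on $\Omega$ such that $G\circ\theta_s=s+G$ for all $s\in\mathbb R^2$, where $s+G$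 is the translate of $G$ by $s$. Finite edge intensity: $\Lambda:=\mathbb E[\#\{(u,v)\in E:[u,v]\cap[0,1]^2\ne\emptyset\}]<\infty$. Connected components are those of the underlying undirected graph. A topological end of a component $C$ is an equivalence class of infinite undirected simple paths in $C$, where two paths are equivalent if their vertex sets differ by only finitely many vertices. A component is $n$-ended if it has exactly $n$ topological ends. *)

(* Defs.v *)
From HB Require Import structures.
From mathcomp Require Import all_boot all_order all_algebra.
From mathcomp Require Import all_classical all_reals all_analysis.
From mathcomp Require Import measurable_realfun.

Set Implicit Arguments.
Unset Strict Implicit.
Unset Printing Implicit Defensive.

Import Order.TTheory GRing.Theory Num.Theory.
Import numFieldNormedType.Exports.

Local Open Scope classical_set_scope.
Local Open Scope ring_scope.

(* The norm of [R * R] is the sup norm (same bounded sets as the Euclidean one),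
   and its canonical sigma-algebra is the Borel one. *)
Notation plane R := (R * R)%type (only parsing).

Definition dot (R : realType) (u v : plane R) : R := u.1 * v.1 + u.2 * v.2.

Definition e2 (R : realType) : plane R := (0, 1).

Definition segment (R : realType) (u v : plane R) : set (plane R) :=
  [set (1 - t) *: u + t *: v | t in `[0, 1]].

Record geograph (R : realType) := Geograph {
  vertices : set (plane R);
  edges : set (plane R * plane R);
  vertices_locally_finite :
    forall D : set (plane R), bounded_set D -> finite_set (vertices `&` D);
  edges_vertices : edges `<=` vertices `*` vertices;
  edges_irrefl : forall v, ~ edges (v, v) }.

Section sigma_field.
Variable R : realType.
Implicit Types G : geograph R.

Definition count_vertices (D : set (plane R)) G : \bar R :=
  counting (vertices G `&` D).

Definition count_edges (H : set (plane R * plane R)) G : \bar R :=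
  counting (edges G `&` H).

Definition count_vertices_events (D : set (plane R)) : set_system (geograph R) :=
  preimage_set_system setT (count_vertices D) measurable.

Definition count_edges_events (H : set (plane R * plane R)) :
    set_system (geograph R) :=
  preimage_set_system setT (count_edges H) measurable.

Definition geograph_measurable : set_system (geograph R) :=
  <<s (\bigcup_(D in [set D : set (plane R) | bounded_set D /\ measurable D])
         count_vertices_events D) `|`
      (\bigcup_(H in [set H : set (plane R * plane R) |
                     bounded_set H /\ measurable H])
         count_edges_events H) >>.

Let empty_locally_finite (D : set (plane R)) :
  bounded_set D -> finite_set (set0 `&` D).
Proof. by rewrite set0I. Qed.

Let empty_edges_vertices :
  (set0 : set (plane R * plane R)) `<=` set0 `*` set0.
Proof. exact: sub0set. Qed.

Let empty_edges_irrefl (v : plane R) :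
  ~ (set0 : set (plane R * plane R)) (v, v).
Proof. by []. Qed.

Definition empty_geograph : geograph R :=
  Geograph empty_locally_finite empty_edges_vertices empty_edges_irrefl.

HB.instance Definition _ := gen_eqMixin (geograph R).
HB.instance Definition _ := gen_choiceMixin (geograph R).
HB.instance Definition _ := isPointed.Build (geograph R) empty_geograph.

Let geograph_measurable0 : geograph_measurable set0.
Proof. exact: sigma_algebra0. Qed.

Let geograph_measurableC (U : set (geograph R)) :
  geograph_measurable U -> geograph_measurable (~` U).
Proof. exact: sigma_algebraC. Qed.

Let geograph_measurableU (F : (set (geograph R))^nat) :
  (forall i, geograph_measurable (F i)) -> geograph_measurable (\bigcup_i F i).
Proof. exact: sigma_algebra_bigcup. Qed.

Definition geograph_display : measure_display.
Proof. by constructor. Qed.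

HB.instance Definition _ := @isMeasurable.Build geograph_display (geograph R)
  geograph_measurable geograph_measurable0 geograph_measurableC
  geograph_measurableU.

End sigma_field.

Section translation.
Variables (R : realType) (s : plane R) (G : geograph R).

Let tvertices : set (plane R) := [set s + v | v in vertices G].

Let tedges : set (plane R * plane R) :=
  [set (s + e.1, s + e.2) | e in edges G].

Let tvertices_locally_finite (D : set (plane R)) :
  bounded_set D -> finite_set (tvertices `&` D).
Proof.
move=> [M [Mreal hM]].
have bD : bounded_set [set v | D (s + v)].
  exists (`|M| + `|s| + 1); split; first exact: num_real.
  move=> N /ltW hN v Dv.
  have nv : `|v| <= `|s + v| + `|s|.
    have /= := ler_normB (s + v) s.
    by rewrite (_ : s + v - s = v)// addrAC subrr add0r.
  apply: (le_trans nv); apply: le_trans hN; rewrite addrAC lerD2r.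
  apply: (hM (`|M| + 1)) => //.
  by rewrite (le_lt_trans (ler_norm _))// ltrDl.
apply: (sub_finite_set _ (finite_image (+%R s)
  (@vertices_locally_finite _ G _ bD))).
by move=> _ [[v Vv <-] Dv]; exists v.
Qed.

Let tedges_vertices : tedges `<=` tvertices `*` tvertices.
Proof.
move=> _ [e Ee <-]; have [V1 V2] := @edges_vertices _ G _ Ee.
by split; [exists e.1|exists e.2].
Qed.

Let tedges_irrefl (v : plane R) : ~ tedges (v, v).
Proof.
move=> [[u u'] Ee [eq1]]; rewrite -eq1.
by move=> /addrI uu'; move: Ee; rewrite uu'; exact: edges_irrefl.
Qed.

Definition translate : geograph R :=
  Geograph tvertices_locally_finite tedges_vertices tedges_irrefl.

End translation.

Section graph.
Variables (R : realType) (G : geograph R).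

Definition adj : rel (plane R) :=
  [rel u v | ((u, v) \in edges G) || ((v, u) \in edges G)].

(* [adj] is irreflexive, and a [ucycle] of size 2 goes back and forth along one
   undirected edge, so the genuine cycles are those of size at least 3. *)
Definition acyclic_on (C : set (plane R)) : Prop :=
  forall c : seq (plane R), {subset c <= C} -> ucycle adj c -> (size c <= 2)%N.

Definition acyclic : Prop := acyclic_on setT.

Definition finite_degrees : Prop :=
  forall v, vertices G v -> finite_set [set u | adj v u].

Definition planar : Prop :=
  forall u u' v v', edges G (u, u') -> edges G (v, v') ->
    segment u u' <> segment v v' ->
    segment u u' `&` segment v v' `<=` [set u; u'] `&` [set v; v'].

Definition oriented : Prop :=
  forall v v', edges G (v, v') -> ~ edges G (v', v).

Definition outdegree_one : Prop :=
  forall v, vertices G v -> exists! v', edges G (v, v').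

Definition directed_path (p : nat -> plane R) : Prop :=
  forall n, edges G (p n, p n.+1).

Definition directed_upwards : Prop :=
  forall p, directed_path p -> dot (p n) (e2 R) @[n --> \oo] --> +oo.

Definition connected_in (C : set (plane R)) (x y : plane R) : Prop :=
  exists p : seq (plane R),
    [/\ path adj x p, last x p = y & {subset x :: p <= C}].

Definition component (x : plane R) : set (plane R) :=
  [set y | connected_in (vertices G) x y].

Definition components : set (set (plane R)) := component @` vertices G.

Definition is_tree (C : set (plane R)) : Prop :=
  [/\ C !=set0, forall x y, C x -> C y -> connected_in C x y & acyclic_on C].

Definition ray (C : set (plane R)) (p : nat -> plane R) : Prop :=
  [/\ injective p, forall n, C (p n) & forall n, adj (p n) (p n.+1)].

Definition ray_equiv (p q : nat -> plane R) : Prop :=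
  finite_set ((range p `\` range q) `|` (range q `\` range p)).

Definition ends (C : set (plane R)) : set (set (nat -> plane R)) :=
  [set [set q | ray C q /\ ray_equiv p q] | p in ray C].

Definition n_ended (n : nat) (C : set (plane R)) : Prop := (ends C #= `I_n)%card.

Definition single_one_ended_tree : Prop :=
  exists C, [/\ components = [set C], is_tree C & n_ended 1 C].

Definition infinitely_many_two_ended_trees : Prop :=
  infinite_set components /\
  forall C, components C -> is_tree C /\ n_ended 2 C.

Definition edges_meeting_unit_square : set (plane R * plane R) :=
  [set e | edges G e /\
           segment e.1 e.2 `&` (`[0, 1] `*` `[0, 1]) !=set0].

End graph.

Section random_graph.
Context (R : realType) (d : measure_display) (Omega : measurableType d).
Variables (P : probability Omega R) (G : Omega -> geograph R).

Definition random_geometric_forest : Prop :=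
  measurable_fun setT G /\
  {ae P, forall w, acyclic (G w) /\ finite_degrees (G w)}.

Record ergodic_action (theta : plane R -> Omega -> Omega) : Prop := {
  action0 : forall w, theta 0 w = w;
  actionD : forall s t w, theta (s + t) w = theta s (theta t w);
  action_measurable :
    measurable_fun setT (fun x : plane R * Omega => theta x.1 x.2);
  action_preserving : forall s A, measurable A -> P (theta s @^-1` A) = P A;
  action_ergodic : forall A, measurable A ->
    (forall s, theta s @^-1` A = A) -> P A = 0%E \/ P A = 1%E }.

Definition stationary_ergodic : Prop :=
  exists theta, ergodic_action theta /\
    forall s w, G (theta s w) = translate s (G w).

(* The integrand is a monotone limit of counting functions of bounded Borel
   sets, hence is measurable as soon as [G] is. *)
Definition edge_intensity : \bar R :=
  (\int[P]_w counting (edges_meeting_unit_square (G w)))%E.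

End random_graph.

(* Main.v *)
Require Import Defs.
From HB Require Import structures.
From mathcomp Require Import finmap.
From mathcomp Require Import all_boot all_order all_algebra.
From mathcomp Require Import all_classical all_reals all_analysis.
From mathcomp Require Import measurable_realfun.
From mathcomp Require Import ring lra zify.

Set Implicit Arguments.
Unset Strict Implicit.
Unset Printing Implicit Defensive.

Import Order.TTheory GRing.Theory Num.Theory.
Import numFieldNormedType.Exports.

Local Open Scope classical_set_scope.
Local Open Scope ring_scope.

(** Every vertex has one outgoing edge, so two vertices are in the same tree
    exactly when their forward paths meet, and a ray of a tree either goes
    forward for ever or ends up going backward for ever. All forward rays of a
    tree are equivalent. So the number of ends is one plus the number of
    ends made of infinite lines of ancestors, and the whole question is which
    edges are [backward_infinite], that is, have infinitely many ancestors.

    The basic tool is the set of edges by which the forward paths leave the lower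
    half-plane below a horizontal line for the last time, the exits of that level
    ([exit_edge]). They are ordered by their crossing point with the line, and
    planarity makes the exits of one tree an interval of this order
    ([trapped_same_tree]): two coalescing paths enclose every path that starts
    between them and stays above the line, while that path must go to infinity.
    The enclosure is proved by counting modulo two the crossings of a horizontal
    ray with the two paths ([crosses_shadow], [no_escape]).

    Probability enters in three ways, each for countably many levels.
    - A stationary family of exits of a level has no extreme member, so that
      almost surely it is empty or unbounded on both sides ([exits_unbounded]).
      Indeed, the events that the largest abscissa has a given integer part are
      disjoint and equally likely.
    - Send a unit mass from each edge with infinitely many ancestors to the next
      edge. On average a unit square receives what it sends, and each such edge
      receives at least one unit, hence exactly one, because the intensity is
      finite ([ae_backward_infinite_unique]): lines of ancestors do not branch,
      and every tree has at most two ends.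
    - Each tree that has a rightmost exit at a level sends a unit mass from there
      to its rightmost exit one unit higher. The intensity of rightmost exits is
      the same at both levels, so almost surely every rightmost exit of the upper
      level is reached ([ae_rightmost_predecessor]).

    By ergodicity there is almost surely one tree, or almost surely several.
    If there is one tree and it has an edge with infinitely many ancestors, then
    some level has such an exit; these exits are then unbounded, although
    they all lie on a single line of ancestors, which has at most one exit per level
    ([no_backward_infinite]). So a single tree has one end. If there are several
    trees, then at high levels some of them are neighbours, so that rightmost exits
    exist; being unbounded, they come from infinitely many trees, and each
    tree is squeezed between two others, so that it has finitely many exits at the
    level. By the second mass transport the tree also has exits at all lower
    levels. One of its finitely many exits thus has ancestors arbitrarily far
    down, hence infinitely many of them ([tree_backward_infinite]), and the tree
    has two ends.

    All events are measurable because the edges can be enumerated measurably: a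
    small box that contains a single edge identifies it ([first_index_bij]), and
    the notions above only quantify over edges and integers. *)

(** * Polygonal lines and the parity of crossings *)

Section crossing.
Variable R : realType.
Implicit Types (p q u v z : plane R).

Lemma segment_sym p q : segment p q = segment q p.
Proof.
have H u v : segment u v `<=` segment v u.
  move=> _ [t /= /itvP t01 <-]; exists (1 - t) => /=.
    by rewrite in_itv/=; apply/andP; split; rewrite ?subr_ge0 ?lerBlDr ?lerDl t01.
  by rewrite subKr addrC.
by apply/seteqP; split; exact: H.
Qed.

Definition abscissa p q (y : R) : R :=
  p.1 + (y - p.2) / (q.2 - p.2) * (q.1 - p.1).

Lemma abscissa_segment p q y : p.2 < q.2 -> p.2 <= y <= q.2 ->
  segment p q (abscissa p q y, y).
Proof.
move=> pq /andP[py yq]; have d0 : q.2 - p.2 != 0 by rewrite subr_eq0 gt_eqF.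
have d1 : 0 < q.2 - p.2 by rewrite subr_gt0.
exists ((y - p.2) / (q.2 - p.2)) => /=.
  rewrite in_itv/= divr_ge0 ?subr_ge0 ?(ltW pq)//=.
  by rewrite ler_pdivrMr// mul1r lerD2r.
by rewrite /abscissa; apply/pair_equal_spec; split => /=;
  rewrite ?/GRing.scale/=; field.
Qed.

Lemma horizontal_segment u v x : u.2 = v.2 -> u.1 <= x <= v.1 ->
  segment u v (x, u.2).
Proof.
move=> uv /andP[ux xv]; have [e|ne] := eqVneq u.1 v.1.
  have -> : x = u.1 by apply/eqP; rewrite eq_le ux andbT e.
  exists 0; first by rewrite /= in_itv/= lexx ler01.
  by rewrite subr0 scale1r scale0r addr0 -surjective_pairing.
have d1 : 0 < v.1 - u.1 by rewrite subr_gt0 lt_neqAle ne (le_trans ux).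
have d0 : v.1 - u.1 != 0 by rewrite gt_eqF.
exists ((x - u.1) / (v.1 - u.1)) => /=.
  rewrite in_itv/= divr_ge0 ?subr_ge0 ?(ltW d1) ?(le_trans ux)//=.
  by rewrite ler_pdivrMr// mul1r lerD2r.
apply/pair_equal_spec; split => /=; rewrite ?/GRing.scale/=; first by field.
by rewrite -uv -mulrDl subrK mul1r.
Qed.

(** The edge [p q] meets the horizontal half-line that starts at [z] and goes to
    the right. The half-open bounds count a vertex at the height of [z] as below,
    so that degenerate positions need no separate treatment. *)
Definition crosses p q z : bool :=
  ((p.2 <= z.2 < q.2) && (z.1 < abscissa p q z.2)) ||
  ((q.2 <= z.2 < p.2) && (z.1 < abscissa q p z.2)).

(** The point [p] lies in the half-strip swept by the segment from [z] to [z'] when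
    it moves to the right. The bounds match those of [crosses]. *)
Definition shadow p z z' : bool :=
  ((z.2 < p.2 <= z'.2) && (abscissa z z' p.2 < p.1)) ||
  ((z'.2 < p.2 <= z.2) && (abscissa z' z p.2 < p.1)).

Lemma crossesC p q z : crosses p q z = crosses q p z.
Proof. by rewrite /crosses orbC. Qed.

Lemma shadowC p z z' : shadow p z z' = shadow p z' z.
Proof. by rewrite /shadow orbC. Qed.

Lemma abscissa_first p q : abscissa p q p.2 = p.1.
Proof. by rewrite /abscissa subrr mul0r mul0r addr0. Qed.

Lemma abscissa_last p q : p.2 < q.2 -> abscissa p q q.2 = q.1.
Proof.
move=> pq; rewrite /abscissa divff ?mul1r ?subr_eq0 ?gt_eqF//.
by rewrite addrC subrK.
Qed.

Lemma same_side_horizontal p q u v : p.2 < q.2 -> u.2 = v.2 ->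
    p.2 <= u.2 <= q.2 -> segment p q `&` segment u v = set0 ->
  (u.1 < abscissa p q u.2) = (v.1 < abscissa p q u.2) /\
  (abscissa p q u.2 < u.1) = (abscissa p q u.2 < v.1).
Proof.
move=> pq uv puq dj; set x := abscissa _ _ _.
have xpq : segment p q (x, u.2) by exact: abscissa_segment.
have h1 : ~ (u.1 <= x <= v.1).
  move=> /(horizontal_segment uv) xuv.
  by have : set0 (x, u.2) by rewrite -dj.
have h2 : ~ (v.1 <= x <= u.1).
  move=> /(horizontal_segment (esym uv)); rewrite -uv segment_sym => xuv.
  by have : set0 (x, u.2) by rewrite -dj.
move: h1 h2; case: (ltgtP u.1 x) => [ux|ux|ux];
  by case: (ltgtP v.1 x) => [vx|vx|vx] /=;
    rewrite ?ux ?vx ?(ltW ux) ?(ltW vx)// ?lexx; intuition.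
Qed.

(** On a common interval of heights the horizontal gap between two lines is affine, so
    a change of sign gives a common point. *)
Lemma same_side p q z z' lo hi : p.2 < q.2 -> z.2 < z'.2 ->
    p.2 <= lo -> z.2 <= lo -> lo <= hi -> hi <= q.2 -> hi <= z'.2 ->
    segment p q `&` segment z z' = set0 ->
  (abscissa z z' lo < abscissa p q lo) = (abscissa z z' hi < abscissa p q hi).
Proof.
move=> pq zz plo zlo lohi hiq hiz dj.
pose f y := abscissa p q y - abscissa z z' y.
have f0 y : lo <= y <= hi -> f y != 0.
  move=> /andP[loy yhi]; rewrite subr_eq0; apply/eqP => e.
  have : set0 (abscissa p q y, y) => [|//].
  rewrite -dj; split; first by apply: abscissa_segment => //; lra.
  by rewrite e; apply: abscissa_segment => //; lra.
have fE t : f (lo + t * (hi - lo)) = (1 - t) * f lo + t * f hi.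
  by rewrite /f /abscissa; field; rewrite !subr_eq0 !gt_eqF.
have := f0 lo; rewrite lexx lohi => /(_ isT) fl0.
have := f0 hi; rewrite lexx lohi => /(_ isT) fh0.
suff : 0 < f lo * f hi.
  rewrite -[LHS]subr_gt0 -[RHS]subr_gt0 -/(f lo) -/(f hi).
  case: (ltgtP 0 (f lo)) fl0 => //= fl _; first by rewrite pmulr_rgt0.
  by rewrite nmulr_rgt0// => /ltW; rewrite leNgt => /negbTE.
rewrite ltNge; apply/negP => ff.
have D0 : f lo - f hi != 0.
  apply/eqP => /subr0_eq e; move: ff; rewrite e -expr2 => ff.
  by have := sqr_ge0 (f hi); rewrite le_eqVlt eq_sym sqrf_eq0 (negPf fh0)/= ltNge ff.
(* the affine function [f] vanishes at the parameter [t] *)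
pose t := f lo / (f lo - f hi).
have t01 : 0 <= t <= 1.
  case: (ltgtP 0 (f lo)) fl0 => //= fl _.
    have fh : f hi <= 0 by rewrite -(pmulr_rle0 _ fl).
    by rewrite /t divr_ge0 ?ler_pdivrMr ?mul1r; lra.
  have fh : 0 <= f hi by rewrite -(nmulr_rle0 _ fl).
  have -> : t = - f lo / (f hi - f lo) by rewrite /t; field; rewrite D0 -opprB oppr_eq0 D0.
  by rewrite divr_ge0 ?ler_pdivrMr ?mul1r; lra.
have /negP : f (lo + t * (hi - lo)) != 0 by apply: f0; apply/andP; split; nra.
by apply; rewrite fE /t; apply/eqP; field.
Qed.

Lemma addb_eqF (x y : bool) : (x (+) y == false) = (x == y).
Proof. by case: x; case: y. Qed.

(** The half-strip swept by the segment from [z] to [z'] is convex and bounded by that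
    segment and the two half-lines. A segment [p q] that avoids the first side
    crosses the other two an even number of times if and only if its endpoints are
    both inside or both outside. *)
Lemma crosses_shadow p q z z' : segment p q `&` segment z z' = set0 ->
  crosses p q z (+) crosses p q z' = shadow p z z' (+) shadow q z z'.
Proof.
wlog pq : p q / p.2 <= q.2.
  move=> H dj; case: (leP p.2 q.2) => [pq|/ltW qp]; first exact: H.
  by rewrite crossesC (crossesC _ _ z') [RHS]addbC H// segment_sym.
wlog zz : z z' / z.2 <= z'.2.
  move=> H dj; case: (leP z.2 z'.2) => [zz|/ltW zz]; first exact: H.
  by rewrite shadowC (shadowC q) [LHS]addbC H// (segment_sym z').
move=> dj.
have cE y : crosses p q y = (p.2 <= y.2 < q.2) && (y.1 < abscissa p q y.2).
  rewrite /crosses; case: (boolP (q.2 <= y.2 < p.2)); rewrite ?orbF//.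
  by move=> /andP[qy yp]; have := le_lt_trans qy yp; rewrite ltNge pq.
have sE y : shadow y z z' = (z.2 < y.2 <= z'.2) && (abscissa z z' y.2 < y.1).
  rewrite /shadow; case: (boolP (z'.2 < y.2 <= z.2)); rewrite ?orbF//.
  by move=> /andP[qy yp]; have := lt_le_trans qy yp; rewrite ltNge zz.
rewrite !cE !sE.
have [qz|zq] := leP q.2 z.2.
  rewrite (ltNge z'.2 q.2) (ltNge z.2 p.2) (le_trans qz zz).
  by rewrite (le_trans pq qz) !andbF.
have [zp|pz] := ltP z'.2 p.2.
  rewrite (leNgt p.2 z.2) (leNgt q.2 z'.2) (le_lt_trans zz zp).
  by rewrite (lt_le_trans zp pq) !andbF.
have [pz1|zp1] := leP p.2 z.2; have [qz1|zq1] := leP q.2 z'.2; rewrite /= ?addbF.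
- have pq1 := le_lt_trans pz1 zq; have zz1 := lt_le_trans zq qz1.
  have := same_side pq1 zz1 pz1 (lexx _) (ltW zq) (lexx _) qz1 dj.
  by rewrite abscissa_first (abscissa_last pq1).
- have pq1 := le_lt_trans pz1 zq; apply/eqP; rewrite addb_eqF; apply/eqP.
  move: zz; rewrite le_eqVlt => /orP[/eqP zz|zz].
    have := same_side_horizontal pq1 zz; rewrite pz1 (ltW zq) -zz.
    by case=> // -> _.
  have := same_side pq1 zz pz1 (lexx _) (ltW zz) (ltW zq1) (lexx _) dj.
  by rewrite abscissa_first abscissa_last.
- apply/esym/eqP; rewrite addb_eqF; apply/eqP.
  have zz1 := lt_le_trans zq qz1.
  move: pq; rewrite le_eqVlt => /orP[/eqP pq|pq].
    rewrite setIC in dj.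
    have := same_side_horizontal zz1 pq; rewrite pz (ltW zp1) -pq.
    by case=> // _ ->.
  have := same_side pq zz1 (lexx _) (ltW zp1) (ltW pq) (lexx _) qz1 dj.
  by rewrite abscissa_first abscissa_last.
- have pq1 := le_lt_trans pz zq1; have zz1 := lt_le_trans zp1 pz.
  have := same_side pq1 zz1 (lexx _) (ltW zp1) pz (ltW zq1) (lexx _) dj.
  by rewrite abscissa_first abscissa_last.
Qed.

Fixpoint line_crosses p (s : seq (plane R)) z : bool :=
  if s is q :: s' then crosses p q z (+) line_crosses q s' z else false.

Fixpoint line_avoids p (s : seq (plane R)) (S : set (plane R)) : Prop :=
  if s is q :: s' then segment p q `&` S = set0 /\ line_avoids q s' S else True.

(** The contributions of the inner vertices cancel modulo two. *)
Lemma line_crosses_shadow p s z z' : line_avoids p s (segment z z') ->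
  line_crosses p s z (+) line_crosses p s z' =
  shadow p z z' (+) shadow (last p s) z z'.
Proof.
elim: s p => [p _|q s IH p] /=; first by rewrite addbb.
case=> /crosses_shadow E /IH {}IH.
by rewrite addbACA E IH -addbA (addbA (shadow q _ _)) addbb.
Qed.

Lemma line_crosses_above p s z : (forall q, q \in p :: s -> z.2 < q.2) ->
  line_crosses p s z = false.
Proof.
elim: s p => [//|q s IH p] H /=; rewrite IH => [|r rs].
  by rewrite /crosses !(leNgt _ z.2) !H ?inE ?eqxx ?orbT.
by apply: H; rewrite inE rs orbT.
Qed.

Lemma line_crosses_below p s z : (forall q, q \in p :: s -> q.2 <= z.2) ->
  line_crosses p s z = false.
Proof.
elim: s p => [//|q s IH p] H /=; rewrite IH => [|r rs].
  by rewrite /crosses !(ltNge z.2) !H ?inE ?eqxx ?orbT ?andbF.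
by apply: H; rewrite inE rs orbT.
Qed.

(** Two polygonal lines that start on the line of height [h], stay above it and end at
    the same point enclose every path that starts between them and stays above the
    same line. Along a path that avoids both, the parity of the
    crossings with them does not change: it is odd at the start, where only the first
    edge on the right counts, and even at points higher than both lines. *)
Lemma no_escape (a c : plane R) (sa sc : seq (plane R)) (b : nat -> plane R) h :
    a.2 = h -> c.2 = h -> (b 0%N).2 = h -> a.1 < (b 0%N).1 < c.1 ->
    (forall q, q \in sa -> h < q.2) -> (forall q, q \in sc -> h < q.2) ->
    sa != [::] -> sc != [::] -> last a sa = last c sc ->
    (forall n, h <= (b n).2) ->
    (forall y, exists n, y < (b n).2) ->
    (forall n, line_avoids a sa (segment (b n) (b n.+1))) ->
    (forall n, line_avoids c sc (segment (b n) (b n.+1))) ->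
  False.
Proof.
move=> ah ch bh /andP[ab bc] sah sch sa0 sc0 lst hb binf ava avc.
pose N z := line_crosses a sa z (+) line_crosses c sc z.
have Nstep n : N (b n) = N (b n.+1).
  apply/eqP; rewrite -addb_eqF /N addbACA !line_crosses_shadow// lst.
  have S0 p : p.2 = h -> shadow p (b n) (b n.+1) = false.
    by rewrite /shadow => ->; rewrite !(ltNge _ h) !hb.
  by rewrite (S0 a)// (S0 c)// addbb.
have Nb n : N (b n) = N (b 0%N) by elim: n => // n <-.
have first p (s : seq (plane R)) : p.2 = h -> (forall q, q \in s -> h < q.2) -> s != [::] ->
    line_crosses p s (b 0%N) = ((b 0%N).1 < p.1).
  case: s => // q s ph sh _ /=; rewrite line_crosses_above ?addbF; last first.
    by move=> r rs; rewrite bh sh.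
  have pq : p.2 < q.2 by rewrite ph sh ?mem_head.
  by rewrite /crosses bh -ph abscissa_first lexx pq ltxx andbF orbF.
have N0 : N (b 0%N) by rewrite /N !first// bc ltNge (ltW ab).
have [M HM] : exists M, forall q, q \in [:: a, c & sa ++ sc] -> q.2 <= M.
  elim: [:: a, c & _] => [|p s [M HM]]; first by exists 0.
  exists (Num.max p.2 M) => q; rewrite inE le_max => /predU1P[->|/HM ->].
    by rewrite lexx.
  by rewrite orbT.
have [n Mn] := binf M.
have : N (b n) by rewrite Nb.
rewrite /N !line_crosses_below// => q qs; apply/ltW/(le_lt_trans _ Mn)/HM;
  move: qs; rewrite !inE mem_cat => /orP[->|->]; rewrite ?orbT//.
Qed.

End crossing.

(** * Planar forests of edges going up *)

Lemma finite_max (R : realType) (T : choiceType) (A : set T) (f : T -> R) :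
  finite_set A -> A !=set0 -> exists2 a, A a & forall b, A b -> f b <= f a.
Proof.
move=> /finite_seqP[s ->]; elim: s => [[x]//|x s IH _].
have [->|/eqP] := eqVneq s [::].
  by exists x => [|y]; rewrite /= ?mem_head// inE => /eqP ->.
case: s IH => // y s IH _; have [|a sa ha] := IH.
  by exists y; rewrite /= mem_head.
have [fx|fx] := leP (f x) (f a).
  exists a => [|b]; first by rewrite /= inE sa orbT.
  by rewrite /= inE => /predU1P[->//|/ha].
exists x => [|b]; first by rewrite /= mem_head.
by rewrite /= inE => /predU1P[->//|/ha/le_lt_trans/(_ fx)/ltW].
Qed.

Section segments.
Variable R : realType.
Implicit Types p q u v : plane R.

Lemma segment_left p q : segment p q p.
Proof.
exists 0; first by rewrite /= in_itv/= lexx ler01.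
by rewrite subr0 scale1r scale0r addr0.
Qed.

Lemma segment_right p q : segment p q q.
Proof. by rewrite segment_sym; exact: segment_left. Qed.

Lemma segmentE p q : segment p q = [set p + t *: (q - p) | t in `[0, 1]].
Proof.
have e t : (1 - t) *: p + t *: q = p + t *: (q - p).
  by rewrite scalerBl scale1r scalerBr addrAC addrA.
by apply/seteqP; split => _ [t t01 <-]; exists t; rewrite ?e.
Qed.

Lemma sub_segment p q u v : segment p q u -> segment p q v ->
  segment u v `<=` segment p q.
Proof.
rewrite segmentE => -[s /= s01 <-] [t /= t01 <-] _ [r /= r01 <-].
exists ((1 - r) * s + r * t).
  move: s01 t01 r01; rewrite /= !in_itv/= => /andP[s0 s1] /andP[t0 t1] /andP[r0 r1].
  by apply/andP; split; nra.
move: (q - p) => d; rewrite !scalerDr !scalerA addrACA -!scalerDl.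
by rewrite subrK scale1r.
Qed.

(** The endpoints of a segment are its extreme points. *)
Lemma segment_extremal p q u v : p != q -> segment p q = segment u v ->
  p = u \/ p = v.
Proof.
move=> pq e.
have [s s01 pE] : segment u v p by rewrite -e; exact: segment_left.
have : segment p q v by rewrite e; exact: segment_right.
have : segment p q u by rewrite e; exact: segment_left.
rewrite segmentE => -[a /= a01 uE] [b /= b01 vE].
have d0 : q - p != 0 by rewrite subr_eq0 eq_sym.
move: (pE); rewrite -{1}uE -{1}vE.
have -> : (1 - s) *: (p + a *: (q - p)) + s *: (p + b *: (q - p)) =
    p + ((1 - s) * a + s * b) *: (q - p).
  move: (q - p) => d'; rewrite !scalerDr !scalerA addrACA -!scalerDl.
  by rewrite subrK scale1r.
rewrite -[RHS]addr0 => /addrI/eqP; rewrite scaler_eq0 (negPf d0) orbF.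
move: s01 a01 b01; rewrite /= !in_itv/= => /andP[s0 s1] /andP[a0 a1] /andP[b0 b1].
rewrite paddr_eq0 ?mulr_ge0 ?subr_ge0// !mulf_eq0.
move=> /andP[/orP[s1'|/eqP a0'] /orP[/eqP s0'|/eqP b0']].
- by move: s1'; rewrite s0' subr0 oner_eq0.
- by right; rewrite -vE b0' scale0r addr0.
- by left; rewrite -uE a0' scale0r addr0.
- by left; rewrite -uE a0' scale0r addr0.
Qed.

End segments.

Notation edge R := (plane R * plane R)%type (only parsing).

Section forest_notions.
Variable R : realType.
Implicit Types (E : set (edge R)) (e : edge R) (h : R).

(** A vertex is represented by its outgoing edge, so that the forest is described by its
    set of edges alone. *)
Fixpoint forward E n e e' : Prop :=
  if n is m.+1 then exists2 e1, E e1 & e1.1 = e.2 /\ forward E m e1 e' else e = e'.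

Fixpoint has_ancestor E n e : Prop :=
  if n is m.+1 then exists2 e1, E e1 & e1.2 = e.1 /\ has_ancestor E m e1 else True.

Definition backward_infinite E e : Prop := forall n, has_ancestor E n e.

Definition same_tree E e e' : Prop :=
  exists n m, exists2 e'', E e'' & forward E n e e'' /\ forward E m e' e''.

(** The last step of a forward path across the line of height [h]. *)
Definition exit_edge E h e : Prop :=
  e.1.2 <= h /\ forall n e', E e' -> forward E n e e' -> h < e'.2.2.

Definition crossing_x h e : R := abscissa e.1 e.2 h.

Definition rightmost E h e : Prop := exit_edge E h e /\
  forall e', E e' -> exit_edge E h e' /\ same_tree E e e' ->
    crossing_x h e' <= crossing_x h e.

Definition crossing h e : Prop := e.1.2 <= h < e.2.2.

(** What remains of the hypotheses on the graph once vertices are forgotten. The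
    last two cases of [uf_planar] cover two edges with the same segment. *)
Record upward_forest E : Prop := UpwardForest {
  uf_next : forall e, E e -> exists2 e', E e' & e'.1 = e.2;
  uf_det : forall e e', E e -> E e' -> e.1 = e'.1 -> e = e';
  uf_up : forall p : nat -> edge R,
    (forall n, E (p n) /\ (p n.+1).1 = (p n).2) ->
    forall h, exists N, forall n, (N <= n)%N -> h < (p n).1.2;
  uf_planar : forall e e' z, E e -> E e' ->
    segment e.1 e.2 z -> segment e'.1 e'.2 z ->
    ((z = e.1 \/ z = e.2) /\ (z = e'.1 \/ z = e'.2)) \/ e.1 = e'.1 \/ e.1 = e'.2;
  uf_fin : forall v, finite_set [set e | E e /\ e.2 = v] }.

(** Long edges may cross a bounded part of a line from far away, so this does not follow
    from local finiteness of the vertices. It comes from the finite intensity. *)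
Definition crossing_finite E : Prop := forall h k : int,
  finite_set [set e | E e /\ crossing h%:~R e /\ Num.floor (crossing_x h%:~R e) = k].

End forest_notions.

Section forest.
Variables (R : realType) (E : set (edge R)).
Hypothesis uf : upward_forest E.
Implicit Types (e : edge R) (h : R).

Definition next_edge e : edge R := xget e [set e' | E e' /\ e'.1 = e.2].

Lemma next_edgeP e : E e -> E (next_edge e) /\ (next_edge e).1 = e.2.
Proof.
move=> /(uf_next uf)[e' Ee' ee']; rewrite /next_edge.
by case: xgetP => [y _ []|/(_ e')/=]//; case.
Qed.

Lemma next_edgeE e e' : E e -> E e' -> e'.1 = e.2 -> e' = next_edge e.
Proof.
by move=> Ee Ee' e12; have [En n1] := next_edgeP Ee; apply: (uf_det uf) => //; rewrite n1.
Qed.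

Lemma iter_next_edge n e : E e -> E (iter n next_edge e).
Proof. by move=> Ee; elim: n => //= n /next_edgeP[]. Qed.

Lemma iter_next_source n e : E e -> (iter n.+1 next_edge e).1 = (iter n next_edge e).2.
Proof. by move=> Ee /=; have [] := next_edgeP (iter_next_edge n Ee). Qed.

Lemma forwardP n e e' : E e -> forward E n e e' <-> e' = iter n next_edge e.
Proof.
elim: n e e' => [|n IH] e e' Ee /=; first by split.
rewrite -iterS iterSr; split => [[e1 Ee1 [e11 /(IH _ _ Ee1) ->]]|->].
  by rewrite (next_edgeE Ee Ee1 e11).
by have [En n1] := next_edgeP Ee; exists (next_edge e) => //; split => //; apply/(IH _ _ En).
Qed.

Lemma same_treeP e e' : E e -> E e' ->
  same_tree E e e' <-> exists n m, iter n next_edge e = iter m next_edge e'.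
Proof.
move=> Ee Ee'; split => [[n [m [e'' _ [nE mE]]]]|[n [m nm]]].
  by exists n, m; rewrite -(proj1 (forwardP _ _ Ee) nE); exact/forwardP.
exists n, m, (iter n next_edge e); first exact: iter_next_edge.
by split; apply/forwardP.
Qed.

Lemma same_tree_refl e : E e -> same_tree E e e.
Proof. by move=> Ee; apply/same_treeP => //; exists 0%N, 0%N. Qed.

Lemma same_tree_sym e e' : same_tree E e e' -> same_tree E e' e.
Proof. by move=> [n [m [e'' ? []]]]; exists m, n, e''. Qed.

Lemma same_tree_trans e e' e'' : E e -> E e' -> E e'' ->
  same_tree E e e' -> same_tree E e' e'' -> same_tree E e e''.
Proof.
move=> Ee Ee' Ee'' /same_treeP - /(_ Ee Ee')[n [m nm]].
move=> /same_treeP - /(_ Ee' Ee'')[p [q pq]]; apply/same_treeP => //.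
by exists (p + n)%N, (m + q)%N; rewrite !iterD nm -pq -!iterD addnC.
Qed.

Lemma same_tree_iter n e : E e -> same_tree E e (iter n next_edge e).
Proof.
move=> Ee; apply/same_treeP => //; first exact: iter_next_edge.
by exists n, 0%N.
Qed.

(** By planarity edges that touch share an endpoint. *)
Lemma touching_same_tree e e' : E e -> E e' ->
  segment e.1 e.2 `&` segment e'.1 e'.2 !=set0 -> same_tree E e e'.
Proof.
move=> Ee Ee' [z [ze ze']].
have H a b : E a -> E b -> a.1 = b.2 -> same_tree E a b.
  move=> Ea Eb /(next_edgeE Eb Ea) ->; apply: same_tree_sym.
  exact: (same_tree_iter 1).
case: (uf_planar uf Ee Ee' ze ze') => [[[->|->] [z'|z']]|[/(uf_det uf Ee Ee') <-|/H]].
- by rewrite (uf_det uf Ee Ee' z'); exact: same_tree_refl.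
- exact: H.
- by apply/same_tree_sym/H.
- apply/same_treeP => //; exists 1%N, 1%N => /=.
  by have [En n1] := next_edgeP Ee; apply: (next_edgeE Ee') => //; rewrite n1.
- exact: same_tree_refl.
- exact.
Qed.

Lemma exit_edgeP h e : E e -> exit_edge E h e <->
  e.1.2 <= h /\ forall n, h < (iter n next_edge e).2.2.
Proof.
move=> Ee; split => -[eh H]; split => // n.
  by apply: H; [exact: iter_next_edge|apply/forwardP].
by move=> e' Ee' /forwardP -> //.
Qed.

Lemma exit_crossing h e : E e -> exit_edge E h e -> crossing h e.
Proof. by move=> Ee /exit_edgeP - /(_ Ee)[eh /(_ 0%N) /= he]; rewrite /crossing eh. Qed.

(** Forward paths go to infinity upwards, so they cross the line a last time. *)
Lemma exists_exit h e : E e -> e.1.2 <= h -> exists n, exit_edge E h (iter n next_edge e).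
Proof.
move=> Ee eh; have [|N HN] := uf_up uf (p := fun n => iter n next_edge e) _ h.
  by move=> n; split; [exact: iter_next_edge|exact: iter_next_source].
have ub n : (iter n next_edge e).1.2 <= h -> (n <= N)%N.
  by rewrite leqNgt => nh; apply/negP => /ltnW/HN; rewrite ltNge nh.
have ex : exists n, (iter n next_edge e).1.2 <= h by exists 0%N.
case: (ex_maxnP ex ub) => n nh mx; exists n; apply/exit_edgeP; first exact: iter_next_edge.
split => // m; rewrite -iterD -iter_next_source// ltNge; apply/negP => /mx.
by rewrite -addSn addnC -[leqRHS]addn0 leq_add2l.
Qed.

Lemma exit_iter_inj h e n : E e -> exit_edge E h e ->
  exit_edge E h (iter n next_edge e) -> n = 0%N.
Proof.
move=> Ee /exit_edgeP - /(_ Ee)[_ H].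
move=> /exit_edgeP - /(_ (iter_next_edge _ Ee))[]; case: n => // n.
by rewrite iter_next_source// leNgt H.
Qed.

Lemma crossing_x_segment h e : crossing h e -> segment e.1 e.2 (crossing_x h e, h).
Proof.
move=> /andP[eh he]; apply: abscissa_segment; first exact: le_lt_trans he.
by rewrite eh ltW.
Qed.

(** Two edges that meet on the line share their lower endpoint, from which only one edge
    goes out. *)
Lemma crossing_x_inj h e e' : E e -> E e' -> crossing h e -> crossing h e' ->
  crossing_x h e = crossing_x h e' -> e = e'.
Proof.
move=> Ee Ee' ce ce' ee'.
have ze := crossing_x_segment ce; have := crossing_x_segment ce'.
rewrite -ee' => ze'; move: ce ce' => /andP[eh he] /andP[eh' he'].
case: (uf_planar uf Ee Ee' ze ze') => [[[z|z] [z'|z']]|[//|e2]].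
- by apply: (uf_det uf) => //; rewrite -z -z'.
- by move: he'; rewrite -z' ltxx.
- by move: he; rewrite -z ltxx.
- by move: he; rewrite -z ltxx.
- exact: (uf_det uf).
- by move: eh; rewrite e2 leNgt he'.
Qed.

Lemma path_avoids e p S n : E e -> segment e.1 e.2 p ->
  (forall k, segment (iter k next_edge e).1 (iter k next_edge e).2 `&` S = set0) ->
  line_avoids p (map snd (traject next_edge e n)) S.
Proof.
elim: n e p => [//|n IH] e p Ee ep H /=; split.
  rewrite -subset0 => z [zp zS]; rewrite -(H 0%N); split => //=.
  by apply: sub_segment zp => //; exact: segment_right.
apply: IH; first by case: (next_edgeP Ee).
  by rewrite -(proj2 (next_edgeP Ee)); exact: segment_left.
by move=> k; have := H k.+1; rewrite iterSr.
Qed.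

(** If [b] were in another tree, its forward path would not touch those of [a] and
    [c] until these meet, and could not go to infinity. *)
Lemma trapped_same_tree h a b c : E a -> E b -> E c ->
  exit_edge E h a -> exit_edge E h b -> exit_edge E h c ->
  crossing_x h a < crossing_x h b < crossing_x h c -> same_tree E a c -> same_tree E a b.
Proof.
move=> Ea Eb Ec xa xb xc abc ac; apply: contrapT => nab.
have nbc : ~ same_tree E c b.
  by move=> cb; apply: nab; apply: same_tree_trans cb.
have disj a' i j : E a' -> ~ same_tree E a' b ->
    segment (iter i next_edge a').1 (iter i next_edge a').2 `&`
    segment (iter j next_edge b).1 (iter j next_edge b).2 = set0.
  move=> Ea' na'; apply: contra_notP na' => /eqP/set0P.
  move=> /touching_same_tree - /(_ (iter_next_edge _ Ea') (iter_next_edge _ Eb)) st.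
  apply: (same_tree_trans Ea' _ Eb (same_tree_iter i Ea')); first exact: iter_next_edge.
  apply: (same_tree_trans _ _ Eb st); try exact: iter_next_edge.
  exact/same_tree_sym/same_tree_iter.
have [n [m nm]] := (same_treeP Ea Ec).1 ac.
(* the path of [b] starts at the crossing point, in the middle of an edge *)
pose bp k := if k is k'.+1 then (iter k' next_edge b).2 else (crossing_x h b, h).
have bpS k : exists j, segment (bp k) (bp k.+1) `<=`
    segment (iter j next_edge b).1 (iter j next_edge b).2.
  case: k => [|k].
    exists 0%N => /=; apply: sub_segment; last exact: segment_right.
    exact/crossing_x_segment/exit_crossing.
  by exists k.+1; rewrite /bp -iter_next_source.
have avoid a' n' k : E a' -> exit_edge E h a' -> ~ same_tree E a' b ->
    line_avoids (crossing_x h a', h) (map snd (traject next_edge a' n'))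
      (segment (bp k) (bp k.+1)).
  move=> Ea' xa' na'; apply: path_avoids => //.
    exact/crossing_x_segment/exit_crossing.
  move=> i; have [j jb] := bpS k; rewrite -subset0 => z [zi /jb zj].
  by rewrite -(disj a' i j Ea' na').
have above a' n' : E a' -> exit_edge E h a' ->
    forall q, q \in map snd (traject next_edge a' n') -> h < q.2.
  move=> Ea' /exit_edgeP - /(_ Ea')[_ H] q /mapP[f /trajectP[i _ ->] ->].
  exact: H.
apply: (@no_escape R (crossing_x h a, h) (crossing_x h c, h)
  (map snd (traject next_edge a n.+1)) (map snd (traject next_edge c m.+1)) bp h) => //.
- exact: above.
- exact: above.
- by rewrite !trajectSr !map_rcons !last_rcons nm.
- move: xb => /exit_edgeP - /(_ Eb)[_ H] [|k] //=; exact/ltW/H.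
- move=> y; have [|N HN] := uf_up uf (p := fun n => iter n next_edge b) _ y.
    by move=> i; split; [exact: iter_next_edge|exact: iter_next_source].
  by exists N.+1; rewrite /bp -iter_next_source//; apply: HN.
- by move=> k; exact: avoid.
- by move=> k; exact: avoid.
Qed.

End forest.

(** * Rightmost exits of the trees *)

Definition unbounded_both (R : realType) (T : Type) (f : T -> R) (S : set T) :=
  forall M : R, (exists2 r, S r & M < f r) /\ (exists2 r, S r & f r < M).

Lemma unbounded_infinite (R : realType) (T : choiceType) (f : T -> R) (S : set T) :
  unbounded_both f S -> infinite_set S.
Proof.
move=> un fS; have [|r Sr rmax] := finite_max f fS.
  by have [[r Sr _] _] := un 0; exists r.
by have [[r' /rmax]] := un (f r); rewrite leNgt => /negbTE ->.
Qed.

Section exits.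
Variables (R : realType) (E : set (edge R)).
Hypotheses (uf : upward_forest E) (cf : crossing_finite E).
Implicit Types (e : edge R) (h k : int).

Definition rightmost_exits (x : R) : set (edge R) := [set e | E e /\ rightmost E x e].

Lemma exits_between_finite h (x y : R) :
  finite_set [set e | E e /\ exit_edge E h%:~R e /\ x <= crossing_x h%:~R e <= y].
Proof.
have [n [xn yn]] : exists n : nat, - n%:R <= x /\ y <= n%:R.
  exists (Num.bound (Num.max `|x| `|y|)).
  have := archi_boundP (x := Num.max `|x| `|y|); rewrite le_max normr_ge0 => /(_ isT).
  rewrite gt_max => /andP[/ltW + /ltW +]; rewrite !ler_norml => /andP[? _] /andP[_ ?].
  by split.
pose g (i : nat) : int := i%:Z - n%:Z.
apply: (@sub_finite_set _ _ (\bigcup_(i in `I_n.*2.+1)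
   [set e | E e /\ crossing h%:~R e /\ Num.floor (crossing_x h%:~R e) = g i])).
  move=> e [Ee [/(exit_crossing uf Ee) ce /andP[xe ye]]].
  have f1 : - n%:Z <= Num.floor (crossing_x h%:~R e).
    by rewrite floor_ge_int ?num_real// intrN; apply: le_trans xe.
  have f2 : Num.floor (crossing_x h%:~R e) <= n%:Z.
    rewrite -(ler_int R) (le_trans (floor_le _)) ?num_real//.
    exact: le_trans ye _.
  exists (absz (Num.floor (crossing_x h%:~R e) + n%:Z)%R); first by rewrite /=; lia.
  by split => //; split => //; rewrite /g; lia.
by apply: bigcup_finite => // i _; exact: cf.
Qed.

(** Exits do not accumulate, so a family bounded on the right has a last member. *)
Lemma exists_max_exit h (S : set (edge R)) a (K : R) :
    (forall e, S e -> E e /\ exit_edge E h%:~R e) ->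
    (forall e, S e -> crossing_x h%:~R e <= K) -> S a ->
  exists2 r, S r & forall e, S e -> crossing_x h%:~R e <= crossing_x h%:~R r.
Proof.
move=> SE SK Sa; have [] := @finite_max R _
    [set e | S e /\ crossing_x h%:~R a <= crossing_x h%:~R e] (crossing_x h%:~R).
- apply: sub_finite_set (exits_between_finite h (crossing_x h%:~R a) K).
  by move=> e [Se ae]; have [Ee xe] := SE _ Se; split => //; split => //; rewrite ae SK.
- by exists a; split.
- move=> r [Sr ar] H; exists r => // e Se.
  have [ae|/ltW ae] := leP (crossing_x h%:~R a) (crossing_x h%:~R e); first exact: H.
  exact: le_trans ar.
Qed.

(** The exits of the tree of [a] cannot jump over [b]. *)
Lemma separated_rightmost h a b : E a -> E b ->
    exit_edge E h%:~R a -> exit_edge E h%:~R b ->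
    crossing_x h%:~R a < crossing_x h%:~R b -> ~ same_tree E a b ->
  exists2 r, rightmost_exits h%:~R r & same_tree E a r.
Proof.
move=> Ea Eb xa xb ab nab.
have [| | |r [Er [xr ar]] H] := @exists_max_exit h
    [set e | E e /\ exit_edge E h%:~R e /\ same_tree E a e] a (crossing_x h%:~R b).
- by move=> e [Ee []].
- move=> e [Ee [xe ae]]; rewrite leNgt; apply/negP => be; apply: nab.
  by apply: (trapped_same_tree uf Ea Eb Ee xa xb xe) => //; rewrite ab.
- by do 2! split => //; exact: same_tree_refl.
- exists r => //; split => //; split => // e Ee [xe re]; apply: H.
  by do 2! split => //; exact: (same_tree_trans uf Ea Er Ee).
Qed.

Lemma exit_separated h a b : E a -> E b ->
    exit_edge E h%:~R a -> exit_edge E h%:~R b ->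
  ~ same_tree E a b -> crossing_x h%:~R a < crossing_x h%:~R b \/
                       crossing_x h%:~R b < crossing_x h%:~R a.
Proof.
move=> Ea Eb xa xb nab.
case: (ltgtP (crossing_x h%:~R a) (crossing_x h%:~R b)); try by [left|right].
move=> ab; exfalso; apply: nab.
rewrite -(crossing_x_inj uf Ea Eb (exit_crossing uf Ea xa) (exit_crossing uf Eb xb) ab).
exact: (same_tree_refl uf).
Qed.

Lemma two_trees_rightmost h a b : E a -> E b ->
    exit_edge E h%:~R a -> exit_edge E h%:~R b ->
  ~ same_tree E a b -> rightmost_exits h%:~R !=set0.
Proof.
move=> Ea Eb xa xb nab; case: (exit_separated Ea Eb xa xb nab) => ab.
  by have [r ? _] := separated_rightmost Ea Eb xa xb ab nab; exists r.
have nba : ~ same_tree E b a by move=> /same_tree_sym.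
by have [r ? _] := separated_rightmost Eb Ea xb xa ab nba; exists r.
Qed.

Lemma rightmost_unique (x : R) r r' : rightmost_exits x r -> rightmost_exits x r' ->
  same_tree E r r' -> r = r'.
Proof.
move=> [Er [xr H]] [Er' [xr' H']] rr'; apply: (crossing_x_inj (h := x) uf Er Er').
- exact: (exit_crossing uf).
- exact: (exit_crossing uf).
- by apply/eqP; rewrite eq_le H ?H'//; split => //; exact: same_tree_sym.
Qed.

(** The almost sure property of stationary forests that the next lemmas rely on. *)
Definition recurrent_level h : Prop := rightmost_exits h%:~R !=set0 ->
  unbounded_both (crossing_x h%:~R) (rightmost_exits h%:~R).

Lemma tree_rightmost h a : recurrent_level h -> rightmost_exits h%:~R !=set0 ->
  E a -> exit_edge E h%:~R a -> exists2 r, rightmost_exits h%:~R r & same_tree E a r.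
Proof.
move=> rec /rec un Ea xa.
have [[r Rr ar] _] := un (crossing_x h%:~R a).
have [|nar] := pselect (same_tree E a r); first by exists r.
by case: Rr (Rr) => Er [xr _] Rr; exact: (separated_rightmost Ea Er xa xr).
Qed.

(** The rightmost exits of other trees lie on both sides of the tree. *)
Lemma tree_exits_finite h a : recurrent_level h -> rightmost_exits h%:~R !=set0 ->
  E a -> exit_edge E h%:~R a ->
  finite_set [set e | E e /\ exit_edge E h%:~R e /\ same_tree E a e].
Proof.
move=> rec n0 Ea xa.
have [r [Er [xr rmax]] ar] := tree_rightmost rec n0 Ea xa.
have [_ [l [El [xl lmax]] la]] := rec n0 (crossing_x h%:~R a).
apply: sub_finite_set (exits_between_finite h (crossing_x h%:~R l) (crossing_x h%:~R r)).
move=> e [Ee [xe ae]]; split => //; split => //; apply/andP; split; last first.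
  apply: rmax => //; split => //.
  apply: (same_tree_trans uf Er Ea Ee) => //; exact: same_tree_sym.
rewrite leNgt; apply/negP => el.
have : same_tree E e l.
  apply: (trapped_same_tree uf Ee El Ea xe xl xa); first by rewrite el la.
  exact: same_tree_sym.
move=> e_l; have /(lmax a Ea) : exit_edge E h%:~R a /\ same_tree E l a.
  by split => //; apply: (same_tree_trans uf El Ee Ea); exact: same_tree_sym.
by rewrite leNgt la.
Qed.

(** A second tree is present at the level of [r], hence also one unit higher, where the
    tree of [r] then has a rightmost exit. *)
Lemma rightmost_next h r : recurrent_level h -> recurrent_level (h + 1) ->
    rightmost_exits h%:~R r ->
  exists2 r', rightmost_exits (h + 1)%:~R r' & same_tree E r r'.
Proof.
move=> rec rec1 Rr; have [Er [xr _]] := Rr.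
have R0 : rightmost_exits h%:~R !=set0 by exists r.
have [[r2 Rr2 rr2] _] := rec R0 (crossing_x h%:~R r); have [Er2 [xr2 _]] := Rr2.
have nst : ~ same_tree E r r2.
  by move=> st; move: rr2; rewrite (rightmost_unique Rr Rr2 st) ltxx.
have up e : E e -> exit_edge E h%:~R e ->
    exists n, exit_edge E (h + 1)%:~R (iter n (next_edge E) e).
  move=> Ee [eh _]; apply: (exists_exit uf Ee); apply: le_trans eh _.
  by rewrite ler_int lerDl.
have [n xn] := up r Er xr; have [m xm] := up r2 Er2 xr2.
have En := iter_next_edge uf n Er; have Em := iter_next_edge uf m Er2.
have nst' : ~ same_tree E (iter n (next_edge E) r) (iter m (next_edge E) r2).
  move=> st; apply: nst; apply: (same_tree_trans uf Er En Er2).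
    exact: same_tree_iter.
  apply: (same_tree_trans uf En Em Er2) => //.
  by apply: same_tree_sym; exact: same_tree_iter.
have R1 := two_trees_rightmost En Em xn xm nst'.
have [r' Rr' nr'] := tree_rightmost rec1 R1 En xn.
exists r' => //; apply: (same_tree_trans uf Er En (proj1 Rr')) => //.
exact: same_tree_iter.
Qed.

End exits.

(** * Infinite lines of ancestors *)

Section ancestors.
Variables (R : realType) (E : set (edge R)).
Hypotheses (uf : upward_forest E) (cf : crossing_finite E).
Implicit Types (e : edge R) (h k : int).
Local Notation next := (next_edge E).

Lemma has_ancestor_iter n m e : E e -> has_ancestor E n e ->
  has_ancestor E (m + n) (iter m next e).
Proof.
move=> Ee en; elim: m => //= m IH.
have Em := iter_next_edge uf m Ee; exists (iter m next e) => //; split => //.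
by have [] := next_edgeP uf Em.
Qed.

Lemma has_ancestorS n e : has_ancestor E n.+1 e -> has_ancestor E n e.
Proof.
elim: n e => [//|n IH] e [e1 Ee1 [e1e /IH a1]].
by exists e1.
Qed.

Lemma has_ancestor_le m n e : (m <= n)%N -> has_ancestor E n e -> has_ancestor E m e.
Proof. by move=> /subnK <-; elim: (n - m)%N => // k IH /has_ancestorS. Qed.

Lemma backward_infinite_iter m e : E e -> backward_infinite E e ->
  backward_infinite E (iter m next e).
Proof.
move=> Ee eb n; apply: (@has_ancestor_le n (m + n)); first exact: leq_addl.
exact: has_ancestor_iter.
Qed.

(** König's lemma: in-degrees are finite. *)
Lemma backward_infinite_child e : backward_infinite E e ->
  exists2 e1, E e1 & e1.2 = e.1 /\ backward_infinite E e1.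
Proof.
move=> eb; apply: contrapT => H.
have H1 c : exists n, E c /\ c.2 = e.1 -> ~ has_ancestor E n c.
  have [[Ec ce]|nc] := pselect (E c /\ c.2 = e.1); last by exists 0%N.
  have [n nn] : exists n, ~ has_ancestor E n c.
    apply: contrapT => /forallNP nc; apply: H; exists c => //.
    by split => // n; exact: contrapT.
  by exists n.
have {H1} [f fP] := choice H1.
have [c0 [Ec0 [c0e _]]] : exists c, E c /\ c.2 = e.1 /\ True.
  by have [c Ec [ce _]] := eb 1%N; exists c.
have [||c [Ec ce] cmax] := @finite_max R _ [set c | E c /\ c.2 = e.1] (fun c => (f c)%:R).
- exact: (uf_fin uf).
- by exists c0.
have [c1 Ec1 [c1e c1a]] := eb (f c).+1.
apply: (fP c1) => //; apply: has_ancestor_le c1a.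
by rewrite -(ler_nat R); exact: cmax.
Qed.

(** König's lemma again, in the contrapositive form. *)
Lemma finite_ancestors e : ~ backward_infinite E e ->
  finite_set [set a | E a /\ exists n, iter n next a = e].
Proof.
move=> /existsNP[D]; elim: D e => [e []//|D IH e nD].
apply: (@sub_finite_set _ _ ([set e] `|`
  \bigcup_(c in [set c | E c /\ c.2 = e.1]) [set a | E a /\ exists n, iter n next a = c])).
  move=> a [Ea [[|n] ne]]; first by left.
  right; exists (iter n next a); last by split => //; exists n.
  by split; [exact: iter_next_edge|rewrite -ne iter_next_source].
rewrite finite_setU; split; first exact: finite_set1.
apply: bigcup_finite; first exact: uf_fin.
by move=> c [Ec ce]; apply: IH => ac; apply: nD; exists c.
Qed.

(** The hypothesis on predecessors gives the tree a rightmost exit at every lower level.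
    The forward paths of these exits lead to the finitely many exits of the tree at a
    fixed level. If each of the latter had finitely many ancestors, the former would not
    go down to minus infinity. *)
Lemma tree_backward_infinite e : E e ->
    (forall h, recurrent_level E h) ->
    (forall h r', rightmost_exits E (h + 1)%:~R r' ->
       exists2 r, rightmost_exits E h%:~R r & same_tree E r r') ->
    (exists2 e', E e' & ~ same_tree E e e') ->
  (exists2 b, E b & same_tree E e b /\ backward_infinite E b) /\
  (exists h, rightmost_exits E h%:~R !=set0).
Proof.
move=> Ee rec prev [e' Ee' nee'].
have [h [eh e'h]] : exists h : int, e.1.2 <= h%:~R /\ e'.1.2 <= h%:~R.
  exists (Num.ceil (Num.max e.1.2 e'.1.2)).
  have := ceil_ge (Num.max e.1.2 e'.1.2); rewrite ge_max => /andP[]; by [].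
have [n xn] := exists_exit uf Ee eh; have [n' xn'] := exists_exit uf Ee' e'h.
set a := iter n next e in xn; set a' := iter n' next e' in xn'.
have Ea : E a by exact: iter_next_edge. have Ea' : E a' by exact: iter_next_edge.
have ea : same_tree E e a by exact: same_tree_iter.
have ea' : same_tree E e' a' by exact: same_tree_iter.
have naa' : ~ same_tree E a a'.
  move=> aa'; apply: nee'; apply: (same_tree_trans uf Ee Ea' Ee'); last exact: same_tree_sym.
  exact: (same_tree_trans uf Ee Ea Ea').
have R0 := two_trees_rightmost uf cf Ea Ea' xn xn' naa'.
split; last by exists h.
have [r0 Rr0 ar0] := tree_rightmost uf cf (rec h) R0 Ea xn.
have desc i : exists2 r, rightmost_exits E (h - i%:Z)%:~R r & same_tree E a r.
  elim: i => [|i [r Rr ar]]; first by exists r0; rewrite ?subr0.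
  have [|r' Rr' rr'] := prev (h - i.+1%:Z) r.
    by rewrite (_ : _ + 1 = h - i%:Z)//; lia.
  exists r' => //; apply: (same_tree_trans uf Ea (proj1 Rr)) => //.
    exact: (proj1 Rr').
  exact: same_tree_sym.
have fin := tree_exits_finite uf cf (rec h) R0 Ea xn.
apply: contrapT => nb.
pose lower : set (edge R) :=
  \bigcup_(x in [set x | E x /\ exit_edge E h%:~R x /\ same_tree E a x])
    [set y | E y /\ exists n, iter n next y = x].
have finA : finite_set lower.
  apply: bigcup_finite => // x [Ex [_ ax]]; apply: finite_ancestors => xb.
  by apply: nb; exists x => //; split => //; exact: (same_tree_trans uf Ee Ea Ex).
have memA i : exists2 r, lower r & r.1.2 <= (h - i%:Z)%:~R.
  have [r [Er [xr rr]] ar] := desc i; exists r; last by case: xr.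
  have rh : r.1.2 <= h%:~R.
    by case: xr => + _ => /le_trans; apply; rewrite ler_int; lia.
  have [m xm] := exists_exit uf Er rh; exists (iter m next r); last by split => //; exists m.
  have Em : E (iter m next r) by exact: iter_next_edge.
  split => //; split => //; apply: (same_tree_trans uf Ea Er Em) => //.
  exact: same_tree_iter.
have [|l Al lmin] := @finite_max R _ _ (fun y : edge R => - y.1.2) finA.
  by have [r Ar _] := memA 0%N; exists r.
have [i] : exists i : nat, (h - i%:Z)%:~R < l.1.2.
  exists (Num.bound (h%:~R - l.1.2)).
  have [h0|h0] := leP 0 (h%:~R - l.1.2).
    by have := archi_boundP h0; rewrite intrD intrN; lra.
  by rewrite intrD intrN; have : 0 <= (Num.bound (h%:~R - l.1.2))%:Z%:~R :> R by []; lra.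
by have [r /lmin + ri] := memA i; lra.
Qed.

Definition backward_infinite_exits h : set (edge R) :=
  [set e | E e /\ (exit_edge E h%:~R e /\ backward_infinite E e)].

(** Ancestors along [backward_infinite] edges are unique, so in a single tree these
    edges form one line, and a line has at most one exit at a level. *)
Lemma no_backward_infinite :
    (forall e e', E e -> E e' ->
     backward_infinite E e -> backward_infinite E e' -> e.2 = e'.2 -> e = e') ->
    (forall h, backward_infinite_exits h !=set0 ->
     unbounded_both (crossing_x h%:~R) (backward_infinite_exits h)) ->
    (forall e e', E e -> E e' -> same_tree E e e') ->
  forall e, E e -> ~ backward_infinite E e.
Proof.
move=> inj unb one e Ee be.
have inj_iter n a b : E a -> E b -> backward_infinite E a -> backward_infinite E b ->
    iter n next a = iter n next b -> a = b.
  elim: n a b => // n IH a b Ea Eb ba bb; rewrite !iterSr => /IH ab.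
  have [Ena a1] := next_edgeP uf Ea; have [Enb b1] := next_edgeP uf Eb.
  apply: inj => //; rewrite -a1 -b1; congr fst; apply: ab => //.
  - exact: (backward_infinite_iter 1).
  - exact: (backward_infinite_iter 1).
have exit_inj h a b :
    backward_infinite_exits h a -> backward_infinite_exits h b -> a = b.
  move=> [Ea [xa ba]] [Eb [xb bb]].
  have [n [m nm]] := (same_treeP uf Ea Eb).1 (one a b Ea Eb).
  wlog le_nm : n m a b Ea xa ba Eb xb bb nm / (n <= m)%N.
    move=> H; case/orP: (leq_total n m) => nm'; first exact: (H n m).
    by apply/esym/(H m n).
  have ab : a = iter (m - n) next b.
    apply: (inj_iter n) => //; [exact: iter_next_edge|exact: backward_infinite_iter|].
    by rewrite -iterD subnKC.
  by move: xa; rewrite ab => /(exit_iter_inj uf Eb xb) ->.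
have [n xn] := exists_exit uf Ee (ceil_ge e.1.2).
have Bn : backward_infinite_exits (Num.ceil e.1.2) (iter n next e).
  by split; [exact: iter_next_edge|split => //; exact: backward_infinite_iter].
have [[b Bb lt_b] _] :=
  unb _ (ex_intro _ _ Bn) (crossing_x (Num.ceil e.1.2)%:~R (iter n next e)).
by move: lt_b; rewrite (exit_inj _ _ _ Bb Bn) ltxx.
Qed.

End ancestors.

(** * Ends of a tree described by a parent map *)

Lemma finite_nat_bound (A : set nat) : finite_set A ->
  exists N, forall n, A n -> (n < N)%N.
Proof.
move=> /finite_seqP[s ->]; exists (\max_(i <- s) i).+1 => n ns.
by rewrite ltnS; apply: (@leq_bigmax_seq _ s xpredT id n).
Qed.

Section ends_of_tree.
Variables (R : realType) (G : geograph R) (C : set (plane R)).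
Variable par : plane R -> plane R.
Hypothesis C_par : forall v, C v -> C (par v).
Hypothesis C_adj : forall u v, C u -> C v ->
  adj G u v <-> par u = v \/ par v = u.
Hypothesis C_free : forall v n, C v -> iter n par v = v -> n = 0%N.
Hypothesis C_coal : forall u v, C u -> C v ->
  exists a b, iter a par u = iter b par v.
Implicit Types (p q : nat -> plane R).

Definition backward_chain p : Prop := forall n, C (p n) /\ par (p n.+1) = p n.

Definition ascending p : Prop := forall n, p n.+1 = par (p n).

Lemma C_iter n v : C v -> C (iter n par v).
Proof. by move=> Cv; elim: n => //= n; exact: C_par. Qed.

Lemma iter_par_inj n m v : C v -> iter n par v = iter m par v -> n = m.
Proof.
wlog nm : n m / (n <= m)%N.
  by move=> H Cv e; case/orP: (leq_total n m) => nm; [exact: H|apply/esym/H].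
move=> Cv e; apply/eqP; rewrite eqn_leq nm -subn_eq0; apply/eqP.
apply: (@C_free (iter n par v)); first exact: C_iter.
by rewrite -iterD subnK.
Qed.

Lemma ascendingE p n m : ascending p -> p (n + m)%N = iter n par (p m).
Proof. by move=> pu; elim: n => // n IH; rewrite addSn pu IH. Qed.

Lemma descendingE p k n m : (forall i, (k <= i)%N -> par (p i.+1) = p i) ->
  (k <= m)%N -> iter n par (p (n + m)%N) = p m.
Proof.
move=> pd km; elim: n => // n IH.
by rewrite iterSr addSn pd ?IH// (leq_trans km)// leq_addl.
Qed.

Lemma ascending_ray v : C v -> ray G C (fun n => iter n par v).
Proof.
move=> Cv; split; first by move=> n m; exact: iter_par_inj.
- by move=> n; exact: C_iter.
- by move=> n; apply/C_adj; [exact: C_iter|exact: C_iter|left].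
Qed.

Lemma backward_ray p : backward_chain p -> ray G C p.
Proof.
move=> pb; have pd i : (0 <= i)%N -> par (p i.+1) = p i by case: (pb i).
split; [|by move=> n; case: (pb n)|move=> n].
- have H n m : (n <= m)%N -> p n = p m -> n = m.
    move=> nm e; apply/eqP; rewrite eqn_leq nm -subn_eq0; apply/eqP.
    apply: (@C_free (p m)); first by case: (pb m).
    by have := @descendingE p 0 (m - n) n pd isT; rewrite subnK// -e.
  move=> n m e; case/orP: (leq_total n m) => nm; first exact: H.
  exact/esym/H.
- by apply/C_adj; [case: (pb n)|case: (pb n.+1)|right; case: (pb n)].
Qed.

(** After a step from a vertex to one of its children, a step to the parent would go
    back to the previous vertex. *)
Lemma ray_dichotomy p : ray G C p -> ascending p \/
  exists k, forall n, (k <= n)%N -> par (p n.+1) = p n.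
Proof.
move=> [pinj pC padj]; have [|/existsNP[k nk]] := pselect (ascending p); [by left|].
right; exists k; elim=> [|n IH]; rewrite ?leqn0.
  by move=> /eqP k0; move: nk; rewrite k0; case/(C_adj (pC _) (pC _)): (padj 0%N) => // ->.
rewrite leq_eqVlt => /predU1P[kn|kn].
  by move: nk; rewrite kn; case/(C_adj (pC _) (pC _)): (padj n.+1) => // ->.
case/(C_adj (pC _) (pC _)): (padj n.+1) => // e.
by move: e; rewrite IH// => /pinj; lia.
Qed.

Lemma ray_equivC p q : ray_equiv p q -> ray_equiv q p.
Proof. by rewrite /ray_equiv setUC. Qed.

Lemma ray_equiv_trans p q r : ray_equiv p q -> ray_equiv q r -> ray_equiv p r.
Proof.
rewrite /ray_equiv => pq qr; have := conj pq qr; rewrite -finite_setU.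
apply: sub_finite_set => x [[px rx]|[rx px]]; have [qx|qx] := pselect (range q x).
- by right; left.
- by left; left.
- by left; right.
- by right; right.
Qed.

Lemma tail_equiv p q a b : (forall n, p (a + n)%N = q (b + n)%N) -> ray_equiv p q.
Proof.
move=> pq; rewrite /ray_equiv finite_setU; split.
- apply: (@sub_finite_set _ _ (p @` `I_a)); last exact/finite_image/finite_II.
  move=> _ [[n _ <-] nq]; exists n => //=; rewrite ltnNge; apply/negP => an.
  by apply: nq; exists (b + (n - a))%N => //; rewrite -pq subnKC.
- apply: (@sub_finite_set _ _ (q @` `I_b)); last exact/finite_image/finite_II.
  move=> _ [[n _ <-] nq]; exists n => //=; rewrite ltnNge; apply/negP => an.
  by apply: nq; exists (a + (n - b))%N => //; rewrite pq subnKC.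
Qed.

Lemma ascending_equiv p q : ray G C p -> ray G C q -> ascending p -> ascending q ->
  ray_equiv p q.
Proof.
move=> [_ pC _] [_ qC _] pu qu.
have [a [b ab]] := C_coal (pC 0%N) (qC 0%N).
apply: (@tail_equiv _ _ a b) => n; rewrite addnC (addnC b) !ascendingE//.
by rewrite -(addn0 a) -(addn0 b) !ascendingE// ab.
Qed.

(** A vertex of the ascending ray that lies on the descending part of the other one
    moves along it towards its top, which it leaves for good after finitely many steps. *)
Lemma ascending_not_equiv p q k : ray G C p -> ray G C q -> ascending p ->
  (forall n, (k <= n)%N -> par (q n.+1) = q n) -> ~ ray_equiv p q.
Proof.
move=> [pinj pC _] [_ qC _] pu qd; rewrite /ray_equiv finite_setU => -[fin _].
have [N HN] : exists N, forall n, (N <= n)%N -> exists2 j, (k <= j)%N & p n = q j.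
  have : finite_set (p @^-1` ((range p `\` range q) `|` q @` `I_k)).
    apply: finite_preimage; first by move=> x y _ _; exact: pinj.
    by rewrite finite_setU; split => //; exact/finite_image/finite_II.
  move=> /finite_nat_bound[N HN]; exists N => n Nn.
  have nA : ~ ((range p `\` range q) `|` q @` `I_k) (p n).
    by move=> /HN; rewrite ltnNge Nn.
  have [j _ jn] : range q (p n).
    by apply: contrapT => nq; apply: nA; left; split => //; exists n.
  exists j => //; rewrite leqNgt; apply/negP => jk; apply: nA; right.
  by exists j.
have [j kj pj] := HN N (leqnn _).
have e1 : p (j - k + N)%N = q k.
  by have := @descendingE q k (j - k) k qd (leqnn k); rewrite subnK// ascendingE// pj.
have [|i ki pi] := HN (j - k + N).+1; first by lia.
have : p (i - k + (j - k + N).+1)%N = p (j - k + N)%N.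
  by have := @descendingE q k (i - k) k qd (leqnn k); rewrite subnK// ascendingE// pi e1.
by move/pinj; lia.
Qed.

Lemma one_ended : C !=set0 -> (forall p, ~ backward_chain p) -> n_ended G 1 C.
Proof.
move=> [v Cv] nb.
have up p : ray G C p -> ascending p.
  move=> pr; case: (ray_dichotomy pr) => // -[k kd].
  case: (nb (fun n => p (k + n)%N)) => n; split; first by case: pr.
  by rewrite addnS kd// leq_addr.
rewrite /n_ended (_ : ends G C = [set ray G C]).
  apply/eq_cardSP; exists (ray G C) => //.
  by rewrite setDv II0.
apply/seteqP; split.
  move=> _ [p pr <-]; apply/seteqP; split => [q []//|q qr]; split => //.
  by apply: ascending_equiv => //; exact: up.
move=> _ ->; exists (fun n => iter n par v); first exact: ascending_ray.
apply/seteqP; split => [q []//|q qr]; split => //.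
by apply: ascending_equiv => //; [exact: ascending_ray|exact: up].
Qed.

(** Lines of ancestors do not branch. *)
Hypothesis chain_inj : forall p q, backward_chain p -> backward_chain q ->
  par (p 0%N) = par (q 0%N) -> p 0%N = q 0%N.

Lemma backward_chain_shift p k : backward_chain p -> backward_chain (fun n => p (k + n)%N).
Proof. by move=> pb n; rewrite addnS; exact: pb. Qed.

Lemma chain_par p : backward_chain p ->
  backward_chain (fun n => if n is m.+1 then p m else par (p 0%N)).
Proof.
move=> pb [|n]; split; case: (pb 0%N) => // H _; [exact: C_par| |];
  by case: (pb n).
Qed.

Lemma chain_iter_inj n p q : backward_chain p -> backward_chain q ->
  iter n par (p 0%N) = iter n par (q 0%N) -> p 0%N = q 0%N.
Proof.
elim: n p q => // n IH p q pb qb; rewrite !iterSr => e.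
by apply: chain_inj => //; have := IH _ _ (chain_par pb) (chain_par qb); exact.
Qed.

Lemma chain_tail p q : backward_chain p -> backward_chain q -> p 0%N = q 0%N -> p =1 q.
Proof.
move=> pb qb e n.
have := @chain_iter_inj n _ _ (backward_chain_shift n pb) (backward_chain_shift n qb).
rewrite /= !addn0; apply.
have H r : backward_chain r -> iter n par (r n) = r 0%N.
  move=> rb; rewrite -{2}(addn0 n) (@descendingE _ 0)// => i _; by case: (rb i).
by rewrite !H.
Qed.

(** Two lines of ancestors in the same tree coalesce in the forward direction; without
    branching, one of them is then a tail of the other. *)
Lemma chain_equiv p q : backward_chain p -> backward_chain q -> ray_equiv p q.
Proof.
move=> pb qb.
have [a [b ab]] := C_coal (proj1 (pb 0%N)) (proj1 (qb 0%N)).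
wlog le_ab : a b p q pb qb ab / (a <= b)%N.
  move=> H; case/orP: (leq_total a b) => ?; first exact: (H a b).
  by apply/ray_equivC/(H b a).
apply: (@tail_equiv _ _ (b - a) 0) => n; rewrite add0n.
have H r m : backward_chain r -> iter m par (r m) = r 0%N.
  move=> rb; rewrite -{2}(addn0 m) (@descendingE _ 0)// => i _; by case: (rb i).
have := chain_tail (backward_chain_shift (b - a) pb) qb; apply; rewrite addn0.
have := @chain_iter_inj b _ _ (backward_chain_shift (b - a) pb) qb.
rewrite /= addn0; apply.
by rewrite -{1}(subnKC le_ab) iterD H.
Qed.

Lemma two_ended p0 : backward_chain p0 -> n_ended G 2 C.
Proof.
move=> pb0; pose v := p0 0%N; have Cv : C v by case: (pb0 0%N).
pose up := fun n => iter n par v.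
have up_ray : ray G C up by exact: ascending_ray.
have up_up : ascending up by [].
have p0_ray := backward_ray pb0.
have p0d n : (0 <= n)%N -> par (p0 n.+1) = p0 n by case: (pb0 n).
pose cl p := [set q | ray G C q /\ ray_equiv p q].
have clE p : ray G C p -> cl p = cl up \/ cl p = cl p0.
  move=> pr; have cl_eq q : ray G C q -> ray_equiv p q -> cl p = cl q.
    move=> qr pq; apply/seteqP; split => r [rr re]; split => //.
      by apply: ray_equiv_trans re; exact: ray_equivC.
    exact: ray_equiv_trans re.
  case: (ray_dichotomy pr) => [pu|[k pk]]; [left|right]; apply: cl_eq => //.
    exact: ascending_equiv.
  have pkb : backward_chain (fun n => p (k + n)%N).
    by move=> n; split; [case: pr|rewrite addnS pk// leq_addr].
  apply: ray_equiv_trans (chain_equiv pkb pb0).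
  exact: (@tail_equiv _ _ k 0).
have ne : cl up <> cl p0.
  move=> e; have : cl up p0 by rewrite e; split => //; exact: (@tail_equiv _ _ 0 0).
  by case=> _; exact: (ascending_not_equiv up_ray p0_ray up_up p0d).
rewrite /n_ended (_ : ends G C = [set cl up; cl p0]).
  apply/eq_cardSP; exists (cl up); first by left.
  apply/eq_cardSP; exists (cl p0); first by split; [right|move=> e; apply: ne].
  rewrite II0 (_ : _ `\ _ `\ _ = set0)//.
  by rewrite -subset0 => x [[[->|->] nx] nx']; [case: nx|case: nx'].
apply/seteqP; split => [_ [p /clE + <-]|_ [->|->]]; first by case=> e; [left|right]; exact: e.
  by exists up.
by exists p0.
Qed.
End ends_of_tree.

(** * Components of the graph *)

Section connected.
Variables (R : realType) (G : geograph R).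
Implicit Types (C : set (plane R)) (x y z : plane R).

Lemma adjE x y : adj G x y <-> edges G (x, y) \/ edges G (y, x).
Proof.
split => [/orP[/set_mem|/set_mem]|[/mem_set|/mem_set] xy]; [by left|by right|..].
  by apply/orP; left.
by apply/orP; right.
Qed.

Lemma adjC x y : adj G x y = adj G y x.
Proof. by rewrite /adj /= orbC. Qed.

Lemma connected_refl C x : C x -> connected_in G C x x.
Proof. by move=> Cx; exists [::]; split => // z; rewrite inE => /eqP ->; rewrite inE. Qed.

Lemma connected_step C x y : C x -> C y -> adj G x y -> connected_in G C x y.
Proof.
move=> Cx Cy xy; exists [:: y]; split => /=; rewrite ?xy//.
by move=> z; rewrite !inE => /orP[/eqP ->|/eqP ->].
Qed.

Lemma connected_trans C x y z :
  connected_in G C x y -> connected_in G C y z -> connected_in G C x z.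
Proof.
move=> [p [xp py Cp]] [q [yq qz Cq]]; exists (p ++ q).
rewrite cat_path last_cat py xp yq; split => // t.
rewrite -cat_cons mem_cat => /orP[/Cp//|tq]; apply: Cq.
by rewrite inE tq orbT.
Qed.

Lemma connected_sym C x y : connected_in G C x y -> connected_in G C y x.
Proof.
move=> [p [+ + +]]; elim: p x => [x _ <- /(_ x)|z p IH x /= /andP[xz zp] py Cp].
  by rewrite mem_head inE => /(_ isT) Cx; exact: connected_refl.
have Cx : C x by have := Cp x; rewrite mem_head inE => /(_ isT).
have Cz : C z by have := Cp z; rewrite !inE eqxx orbT => /(_ isT).
apply: (@connected_trans _ _ z); last by apply: connected_step; rewrite 1?adjC.
by apply: IH => // t tp; apply: Cp; rewrite inE tp orbT.
Qed.

Lemma connected_end C x y : connected_in G C x y -> C x /\ C y.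
Proof.
move=> [p [_ <- Cp]]; split.
  by have := Cp x; rewrite mem_head inE => /(_ isT).
by have := Cp (last x p); rewrite mem_last inE => /(_ isT).
Qed.

End connected.

Section good_graph.
Variables (R : realType) (G : geograph R).
Hypotheses (finG : finite_degrees G) (plG : planar G) (outG : outdegree_one G)
  (upG : directed_upwards G) (acG : acyclic G).
Let E := edges G.
Let V := vertices G.

Lemma edge_ends (e : edge R) : E e -> V e.1 /\ V e.2.
Proof. exact: (@edges_vertices _ G e). Qed.

(** The heights along a forward path come from [directed_upwards] and planarity from
    [planar]; segments that coincide have the same extreme points. *)
Lemma upward_forest_edges : upward_forest E.
Proof.
split.
- move=> e /edge_ends[_ /outG[v' [ev' _]]]; by exists (e.2, v').
- move=> [u u'] [v v'] Eu Ev /= uv; move: Ev; rewrite -uv => Ev.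
  have [/= Vu _] := edge_ends Eu; have [w [_ wu]] := outG Vu.
  by rewrite -(wu _ Eu) -(wu _ Ev).
- move=> p pE h; have dp : directed_path G (fun n => (p n).1).
    by move=> n; have [Ep ->] := pE n; rewrite -surjective_pairing.
  have /cvgryPgt/(_ h) [N _ HN] := upG dp.
  exists N => n /HN /=.
  by rewrite /dot /e2 /= mulr0 mulr1 add0r.
- move=> [u u'] [v v'] z /= Eu Ev zu zv.
  have uu' : u != u' by apply/eqP => e; move: Eu; rewrite e; exact: edges_irrefl.
  have [e|ne] := pselect (segment u u' = segment v v').
    by right; exact: segment_extremal e.
  left; have [] := plG Eu Ev ne (conj zu zv).
  by move=> [->|->] [->|->]; split; auto.
- move=> v; have [Vv|nV] := pselect (V v); last first.
    rewrite (_ : [set _ | _] = set0)//; rewrite -subset0 => e [Ee ev].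
    by apply: nV; rewrite -ev; exact: (edge_ends Ee).2.
  apply: (@sub_finite_set _ _ ((fun u => (u, v)) @` [set u | adj G v u])).
    move=> [a b] [Ee /= <-]; exists a => //; apply/adjE; by right.
  exact/finite_image/finG.
Qed.
Let uf := upward_forest_edges.

Definition out_edge (v : plane R) : edge R := xget (v, v) [set e | E e /\ e.1 = v].
Definition parent (v : plane R) : plane R := (out_edge v).2.

Lemma out_edgeP v : V v -> E (out_edge v) /\ (out_edge v).1 = v.
Proof.
move=> /outG[v' [vv' _]]; rewrite /out_edge; case: xgetP => [e _ []//|/(_ (v, v'))].
by case.
Qed.

Lemma out_edge_parent v : V v -> E (v, parent v).
Proof. by move=> /out_edgeP[Ee e1]; rewrite -{1}e1 -surjective_pairing. Qed.

Lemma out_edgeE v e : V v -> E e -> e.1 = v -> e = out_edge v.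
Proof.
move=> Vv Ee ev; have [Eo o1] := out_edgeP Vv; apply: (uf_det uf) => //.
by rewrite o1.
Qed.

Lemma parentE v v' : E (v, v') -> v' = parent v.
Proof.
move=> Ev; have [/= Vv _] := edge_ends Ev.
by rewrite /parent -(out_edgeE Vv Ev).
Qed.

Lemma V_parent v : V v -> V (parent v).
Proof. by move=> /out_edge_parent/edge_ends[]. Qed.

Lemma V_iter n v : V v -> V (iter n parent v).
Proof. by move=> Vv; elim: n => //= n; exact: V_parent. Qed.

Lemma out_edge_iter n v : V v -> out_edge (iter n parent v) = iter n (next_edge E) (out_edge v).
Proof.
move=> Vv; elim: n => //= n <-; have Vn := V_iter n Vv.
have [En n1] := out_edgeP Vn; apply: (next_edgeE uf) => //.
  exact: (out_edgeP (V_parent Vn)).1.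
exact: (out_edgeP (V_parent Vn)).2.
Qed.

Lemma adj_parent u v : V u -> V v -> adj G u v <-> parent u = v \/ parent v = u.
Proof.
move=> Vu Vv; rewrite adjE; split => [[/parentE ->|/parentE ->]|[<-|<-]]; auto.
- by left; exact: out_edge_parent.
- by right; exact: out_edge_parent.
Qed.

Lemma parent_free v n : V v -> iter n parent v = v -> n = 0%N.
Proof.
move=> Vv nv; case: n nv => // n nv.
have [|N HN] := uf_up uf (p := fun i => iter i (next_edge E) (out_edge v)) _ v.2.
  move=> i; have [Eo _] := out_edgeP Vv.
  by split; [exact: (iter_next_edge uf)|exact: (iter_next_source uf)].
have := HN (N * n.+1)%N; rewrite -out_edge_iter//.
have -> : iter (N * n.+1) parent v = v.
  by elim: N {HN} => // N IH; rewrite mulSn iterD IH.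
by rewrite (out_edgeP Vv).2 ltxx leq_pmulr// => /(_ isT).
Qed.

Lemma same_tree_out_edge u v : V u -> V v ->
  same_tree E (out_edge u) (out_edge v) <-> exists a b, iter a parent u = iter b parent v.
Proof.
move=> Vu Vv; have [Eu _] := out_edgeP Vu; have [Ev _] := out_edgeP Vv.
split=> [/(same_treeP uf Eu Ev)[a [b]]|[a [b ab]]].
  rewrite -!out_edge_iter// => ab; exists a, b.
  by rewrite -(out_edgeP (V_iter a Vu)).2 ab (out_edgeP (V_iter b Vv)).2.
by apply/(same_treeP uf Eu Ev); exists a, b; rewrite -!out_edge_iter// ab.
Qed.

Lemma connected_same_tree u v : connected_in G V u v ->
  same_tree E (out_edge u) (out_edge v).
Proof.
move=> [p [+ + +]]; elim: p u => [u _ <- /(_ u)|w p IH u /= /andP[uw wp] pv Vp].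
  rewrite mem_head inE => /(_ isT) Vu.
  exact/(same_tree_refl uf)/(out_edgeP Vu).1.
have Vu : V u by have := Vp u; rewrite mem_head inE => /(_ isT).
have Vw : V w by have := Vp w; rewrite !inE eqxx orbT => /(_ isT).
have Vv : V v by have := Vp v; rewrite -pv in_cons mem_last orbT inE => /(_ isT).
have wv : same_tree E (out_edge w) (out_edge v).
  by apply: IH => // t tp; apply: Vp; rewrite inE tp orbT.
apply: (same_tree_trans uf (out_edgeP Vu).1 (out_edgeP Vw).1 (out_edgeP Vv).1) => //.
apply/same_tree_out_edge => //.
by case/(adj_parent Vu Vw): uw => <-; [exists 1%N, 0%N|exists 0%N, 1%N].
Qed.

Lemma connected_iter C n v : C `<=` V -> (forall u, C u -> C (parent u)) -> C v ->
  connected_in G C v (iter n parent v).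
Proof.
move=> CV Cp Cv; have Cn m : C (iter m parent v) by elim: m => //= m; exact: Cp.
elim: n => [|n IH]; first exact: connected_refl.
apply: connected_trans IH _; apply: connected_step; [exact: Cn|exact: (Cn n.+1)|].
by apply/(adj_parent (CV _ (Cn n)) (CV _ (Cn n.+1))); left.
Qed.

Lemma same_tree_connected C u v : C `<=` V -> (forall w, C w -> C (parent w)) ->
  C u -> C v -> same_tree E (out_edge u) (out_edge v) -> connected_in G C u v.
Proof.
move=> CV Cp Cu Cv; move/(same_tree_out_edge (CV _ Cu) (CV _ Cv)) => [a [b ab]].
apply: connected_trans (connected_iter a CV Cp Cu) _; rewrite ab.
exact/connected_sym/connected_iter.
Qed.

Lemma componentE x : V x ->
  component G x = [set y | V y /\ same_tree E (out_edge x) (out_edge y)].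
Proof.
move=> Vx; apply/seteqP; split => [y xy|y [Vy xy]].
  by split; [case: (connected_end xy)|exact: connected_same_tree].
apply: same_tree_connected => //; exact: V_parent.
Qed.

Section component.
Variable x : plane R.
Hypothesis Vx : V x.
Let C := component G x.

Lemma component_V : C `<=` V.
Proof. by rewrite /C componentE// => y []. Qed.

Lemma component_parent v : C v -> C (parent v).
Proof.
move=> xv; have Vv := component_V xv; apply: connected_trans xv _.
exact: (connected_iter 1 (@subset_refl _ V) V_parent).
Qed.

Lemma component_coalesce u v : C u -> C v ->
  exists a b, iter a parent u = iter b parent v.
Proof.
move=> Cu Cv; have Vu := component_V Cu; have Vv := component_V Cv.
apply/same_tree_out_edge => //; apply: connected_same_tree.
by apply: connected_trans (connected_sym Cu) _.
Qed.

Lemma component_adj u v : C u -> C v -> adj G u v <-> parent u = v \/ parent v = u.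
Proof. by move=> /component_V Vu /component_V; exact: adj_parent. Qed.

Lemma component_free v n : C v -> iter n parent v = v -> n = 0%N.
Proof. by move=> /component_V; exact: parent_free. Qed.

(** Forward paths stay in the component, so coalescence gives connectedness inside it. *)
Lemma component_tree : is_tree G C.
Proof.
split; first by exists x; exact: connected_refl.
  move=> u v Cu Cv; have Vu := component_V Cu; have Vv := component_V Cv.
  apply: same_tree_connected => //; [exact: component_V|exact: component_parent|].
  by apply: connected_same_tree; apply: connected_trans (connected_sym Cu) _.
by move=> c _; apply: acG => v _; rewrite inE.
Qed.

Lemma chain_backward_infinite p : backward_chain C parent p ->
  backward_infinite E (out_edge (p 0%N)).
Proof.
move=> pb n; elim: n p pb => //= n IH p pb.
have Vp i : V (p i) by case: (pb i) => /component_V.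
exists (out_edge (p 1%N)); first exact: (out_edgeP (Vp _)).1.
split; last exact: (IH (fun i => p i.+1)).
by rewrite (out_edgeP (Vp _)).2; case: (pb 0%N).
Qed.

Lemma one_ended_component : (forall e, E e -> ~ backward_infinite E e) -> n_ended G 1 C.
Proof.
move=> nb; apply: (one_ended component_parent component_adj component_free component_coalesce).
  by exists x; exact: connected_refl.
move=> p pb; apply: (nb (out_edge (p 0%N))); last exact: chain_backward_infinite.
by apply: (out_edgeP _).1; case: (pb 0%N) => /component_V.
Qed.

Lemma two_ended_component :
    (forall e e', E e -> E e' ->
       backward_infinite E e -> backward_infinite E e' -> e.2 = e'.2 -> e = e') ->
    (exists2 e, E e & same_tree E (out_edge x) e /\ backward_infinite E e) ->
  n_ended G 2 C.
Proof.
move=> binj [b Eb [xb bb]].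
have inj p q : backward_chain C parent p -> backward_chain C parent q ->
    parent (p 0%N) = parent (q 0%N) -> p 0%N = q 0%N.
  move=> pb qb e; have Vp : V (p 0%N) by case: (pb 0%N) => /component_V.
  have Vq : V (q 0%N) by case: (qb 0%N) => /component_V.
  have := binj _ _ (out_edgeP Vp).1 (out_edgeP Vq).1
    (chain_backward_infinite pb) (chain_backward_infinite qb) e.
  by move=> pq; rewrite -(out_edgeP Vp).2 pq (out_edgeP Vq).2.
have H e : exists e1, E e /\ backward_infinite E e ->
    [/\ E e1, backward_infinite E e1 & e1.2 = e.1].
  have [[Ee be]|ne] := pselect (E e /\ backward_infinite E e).
    by have [e1 E1 [e11 b1]] := backward_infinite_child uf be; exists e1.
  by exists e.
have [f fP] := choice H.
pose q n := iter n f b.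
have qP n : E (q n) /\ backward_infinite E (q n).
  by elim: n => // n IH; have [] := fP _ IH.
have qC n : C (q n).1.
  rewrite /C componentE//; have [Vq _] := edge_ends (qP n).1; split => //.
  rewrite -(out_edgeE Vq (qP n).1)//.
  elim: n {Vq} => // n IH; have [En _] := qP n; have [En1 _] := qP n.+1.
  apply: (same_tree_trans uf (out_edgeP Vx).1 En En1) => //.
  have [_ _ e] := fP _ (qP n); apply: same_tree_sym.
  rewrite [X in same_tree _ _ X](next_edgeE uf En1 En)//.
  exact: (same_tree_iter uf 1 En1).
apply: (two_ended component_parent component_adj component_free component_coalesce inj).
instantiate (1 := fun n => (q n).1) => n; split => //.
have [Vq _] := edge_ends (qP n.+1).1.
by rewrite /parent -(out_edgeE Vq (qP n.+1).1)//; have [] := fP _ (qP n).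
Qed.

End component.

Lemma single_tree : V !=set0 -> (forall e e', E e -> E e' -> same_tree E e e') ->
  (forall e, E e -> ~ backward_infinite E e) -> single_one_ended_tree G.
Proof.
move=> [x Vx] one nb; exists (component G x); split; last exact: one_ended_component.
  apply/seteqP; split => [_ [y Vy <-]|_ ->]; last by exists x.
  rewrite /= !componentE//; apply/seteqP.
  by split => z [Vz _]; split => //; apply: one; exact: (out_edgeP _).1.
exact: component_tree.
Qed.

Lemma many_trees (S : set (edge R)) : infinite_set S -> S `<=` E ->
    (forall e e', S e -> S e' -> same_tree E e e' -> e = e') ->
    (forall e e', E e -> E e' ->
       backward_infinite E e -> backward_infinite E e' -> e.2 = e'.2 -> e = e') ->
    (forall e, E e -> exists2 b, E b & same_tree E e b /\ backward_infinite E b) ->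
  infinitely_many_two_ended_trees G.
Proof.
move=> Sinf SE Sinj binj eb; split.
  apply: contra_not Sinf => fin.
  pose g (C : set (plane R)) : edge R :=
    xget (0, 0, (0, 0)) [set e | S e /\ component G e.1 = C].
  apply: sub_finite_set (finite_image g fin) => e Se.
  have [Ve _] := edge_ends (SE _ Se).
  exists (component G e.1); first by exists e.1.
  rewrite /g; case: xgetP => [e' _ [Se' ee']|/(_ e)[]//].
  have [Ve' _] := edge_ends (SE _ Se').
  apply: Sinj => //; rewrite (out_edgeE Ve (SE _ Se))// (out_edgeE Ve' (SE _ Se'))//.
  have : component G e.1 e'.1 by rewrite -ee'; exact: connected_refl.
  by move=> c; apply: connected_same_tree; exact: connected_sym.
move=> _ [x Vx <-]; split; first exact: component_tree.
apply: two_ended_component => //.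
exact/eb/(out_edgeP Vx).1.
Qed.

End good_graph.

(** * Measurable events *)

Section events.
Context d (Omega : measurableType d) (R : realType).
Implicit Types (S : Omega -> Prop) (f g : Omega -> R).

(** Events are written as predicates, so that measurability follows the logical
    structure of the statement. *)
Definition event S : Prop := measurable [set w | S w].

Lemma event_ext S S' : (forall w, S w <-> S' w) -> event S -> event S'.
Proof.
move=> SS'; rewrite /event (_ : [set w | S w] = [set w | S' w])//.
by apply/seteqP; split => w /SS'.
Qed.

Lemma event_cst (Q : Prop) : event (fun=> Q).
Proof.
have [q|nq] := pselect Q.
  by apply: event_ext (measurableT); split.
by apply: event_ext (measurable0); split.
Qed.

Lemma event_not S : event S -> event (fun w => ~ S w).
Proof. exact: measurableC. Qed.

Lemma event_and S S' : event S -> event S' -> event (fun w => S w /\ S' w).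
Proof. exact: measurableI. Qed.

Lemma event_or S S' : event S -> event S' -> event (fun w => S w \/ S' w).
Proof. exact: measurableU. Qed.

Lemma event_imp S S' : event S -> event S' -> event (fun w => S w -> S' w).
Proof.
move=> mS mS'; apply: event_ext (event_or (event_not mS) mS') => w; split.
  by case.
by move=> h; have [/h|] := pselect (S w); [right|left].
Qed.

Lemma event_ex (I : countType) (F : I -> Omega -> Prop) :
  (forall i, event (F i)) -> event (fun w => exists i, F i w).
Proof.
move=> mF; pose F' n : set Omega := if unpickle n is Some i then [set w | F i w] else set0.
have : measurable (\bigcup_n F' n).
  apply: bigcupT_measurable => n; rewrite /F'.
  by case: unpickle => [i|]; [exact: mF|exact: measurable0].
apply: event_ext => w; split => [[n _]|[i Fi]].
  by rewrite /F'; case: unpickle => // i; exists i.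
by exists (pickle i) => //; rewrite /F' pickleK.
Qed.

Lemma event_all (I : countType) (F : I -> Omega -> Prop) :
  (forall i, event (F i)) -> event (fun w => forall i, F i w).
Proof.
move=> mF; apply: event_ext (event_not (event_ex (fun i => event_not (mF i)))) => w.
split=> [h i|h [i]]; last exact.
by apply: contrapT => ni; apply: h; exists i.
Qed.

Lemma event_bool (b : Omega -> bool) : measurable_fun setT b -> event (fun w => b w).
Proof.
move=> mb; have h : measurable (b @^-1` [set true]).
  by rewrite -[X in measurable X]setTI; exact: mb.
by apply: event_ext h.
Qed.

Lemma event_le f g : measurable_fun setT f -> measurable_fun setT g ->
  event (fun w => f w <= g w).
Proof. by move=> mf mg; apply: event_bool; exact: measurable_fun_ler. Qed.

Lemma event_lt f g : measurable_fun setT f -> measurable_fun setT g ->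
  event (fun w => f w < g w).
Proof. by move=> mf mg; apply: event_bool; exact: measurable_fun_ltr. Qed.

Lemma event_floor f k : measurable_fun setT f -> event (fun w => Num.floor (f w) = k).
Proof.
move=> mf; apply: (@event_ext (fun w => k%:~R <= f w /\ f w < (k + 1)%:~R)).
  move=> w; split => [[kf fk]|/eqP].
    by apply/eqP; rewrite floor_eq kf.
  by rewrite floor_eq => /andP.
by apply: event_and; [apply: event_le|apply: event_lt].
Qed.

(** The inverse of [x] is [x] times the inverse of the nonnegative [x ^+ 2], which is
    a real power. *)
Lemma measurable_inv f : measurable_fun setT f -> measurable_fun setT (fun w => (f w)^-1).
Proof.
move=> mf; rewrite (_ : (fun w => _) = (fun w => f w * ((f w ^+ 2) `^ (-1)))).
  apply: measurable_funM => //.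
  exact: (measurableT_comp (measurable_powR (-1)) (measurable_funX 2 mf)).
apply/funext => w; rewrite powR_inv1 ?sqr_ge0// expr2.
have [->|f0] := eqVneq (f w) 0; first by rewrite invr0 mul0r.
by rewrite invfM mulrA divff// mul1r.
Qed.

Section coordinates.
Variable a : Omega -> edge R.
Hypothesis ma : measurable_fun setT a.

Lemma measurable_source : measurable_fun setT (fun w => (a w).1).
Proof. exact: (measurableT_comp measurable_fst ma). Qed.
Lemma measurable_target : measurable_fun setT (fun w => (a w).2).
Proof. exact: (measurableT_comp measurable_snd ma). Qed.
Lemma measurable_source_x : measurable_fun setT (fun w => (a w).1.1).
Proof. exact: (measurableT_comp measurable_fst measurable_source). Qed.
Lemma measurable_source_y : measurable_fun setT (fun w => (a w).1.2).
Proof. exact: (measurableT_comp measurable_snd measurable_source). Qed.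
Lemma measurable_target_x : measurable_fun setT (fun w => (a w).2.1).
Proof. exact: (measurableT_comp measurable_fst measurable_target). Qed.
Lemma measurable_target_y : measurable_fun setT (fun w => (a w).2.2).
Proof. exact: (measurableT_comp measurable_snd measurable_target). Qed.

Lemma measurable_crossing_x h : measurable_fun setT (fun w => crossing_x h (a w)).
Proof.
rewrite /crossing_x /abscissa.
apply: measurable_funD; first exact: measurable_source_x.
apply: measurable_funM; last first.
  by apply: measurable_funB; [exact: measurable_target_x|exact: measurable_source_x].
apply: measurable_funM; first by apply: measurable_funB => //; exact: measurable_source_y.
apply: measurable_inv.
by apply: measurable_funB; [exact: measurable_target_y|exact: measurable_source_y].
Qed.

End coordinates.

Lemma event_eq f g : measurable_fun setT f -> measurable_fun setT g ->
  event (fun w => f w = g w).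
Proof.
move=> mf mg; apply: event_ext (event_and (event_le mf mg) (event_le mg mf)) => w.
by split => [[fg gf]|->]; [apply/eqP; rewrite eq_le fg gf|rewrite lexx].
Qed.

Lemma event_eq_plane (u v : Omega -> plane R) :
  measurable_fun setT u -> measurable_fun setT v -> event (fun w => u w = v w).
Proof.
move=> mu mv; apply: (@event_ext (fun w => (u w).1 = (v w).1 /\ (u w).2 = (v w).2)).
  move=> w; split => [|->//]; case: (u w) => a b; case: (v w) => a' b' /=.
  by case=> -> ->.
by apply: event_and; apply: event_eq; (apply: measurableT_comp => //);
  (exact: measurable_fst || exact: measurable_snd).
Qed.

Lemma event_eq_edge (a b : Omega -> edge R) :
  measurable_fun setT a -> measurable_fun setT b -> event (fun w => a w = b w).
Proof.
move=> ma mb; apply: (@event_ext (fun w => (a w).1 = (b w).1 /\ (a w).2 = (b w).2)).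
  move=> w; split => [|->//]; case: (a w) => u v; case: (b w) => u' v' /=.
  by case=> -> ->.
by apply: event_and; apply: event_eq_plane;
  (exact: measurable_source || exact: measurable_target).
Qed.

End events.

(** * A measurable enumeration of the edges *)

Section cells.
Variable R : realType.
Implicit Types (e : edge R) (n : nat).

Definition grid n e : (int * int) * (int * int) :=
  let fl x := Num.floor (n.+1%:R * x) in
  ((fl e.1.1, fl e.1.2), (fl e.2.1, fl e.2.2)).

Definition cell (c : nat * ((int * int) * (int * int))) : set (edge R) :=
  [set e | grid c.1 e = c.2].

Lemma measurable_cell c : measurable (cell c).
Proof.
case: c => n [[a b] [a' b']].
have mid : measurable_fun setT (@id (edge R)) by exact: measurable_id.
have mm (f : edge R -> R) k : measurable_fun setT f ->
    event (fun e => Num.floor (n.+1%:R * f e) = k).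
  by move=> mf; apply: event_floor; exact: measurable_funM.
have := event_and
  (event_and (mm _ a (measurable_source_x mid)) (mm _ b (measurable_source_y mid)))
  (event_and (mm _ a' (measurable_target_x mid)) (mm _ b' (measurable_target_y mid))).
apply: event_ext => e; split => [[[h1 h2] [h3 h4]]|[h1 h2 h3 h4]].
  by rewrite /cell /grid /= h1 h2 h3 h4.
by rewrite /= h1 h2 h3 h4.
Qed.

Lemma floor_close n (x y : R) : Num.floor (n.+1%:R * x) = Num.floor (n.+1%:R * y) ->
  `|x - y| < n.+1%:R^-1.
Proof.
move=> e; have n0 : 0 < n.+1%:R :> R by rewrite ltr0n.
have := floor_itv (n.+1%:R * x); have := floor_itv (n.+1%:R * y).
rewrite e intrD; set k := _%:~R => /andP[y1 y2] /andP[x1 x2].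
rewrite -[ltRHS]mul1r ltr_pdivlMr// -[X in _ * X](gtr0_norm n0) -normrM.
by rewrite ltr_norml; apply/andP; split; nra.
Qed.

Lemma grid_close n e e' : grid n e = grid n e' -> `|e - e'| < n.+1%:R^-1.
Proof.
case=> h1 h2 h3 h4; rewrite !prod_normE !gt_max.
by rewrite !floor_close.
Qed.

Lemma bounded_cell c : bounded_set (cell c).
Proof.
have [->|/set0P[e0 ce0]] := eqVneq (cell c) set0.
  by exists 0; split; [exact: num_real|move=> M _ x []].
exists (`|e0| + 1); split; first exact: num_real.
move=> M /ltW eM e ce; apply: le_trans eM.
rewrite -lerBlDl; apply: le_trans (lerB_dist _ _) _.
have /grid_close/ltW/le_trans : grid c.1 e = grid c.1 e0 by rewrite ce ce0.
by apply; rewrite invf_le1 ?ler1n ?ltr0n.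
Qed.

(** By local finiteness the nearest other edge is at a positive distance. *)
Lemma cell_isolates (X : set (edge R)) e :
    (forall D, bounded_set D -> finite_set (X `&` D)) -> X e ->
  exists n, X `&` cell (n, grid n e) = [set e].
Proof.
move=> Xfin Xe; pose B : set (edge R) := [set e' | `|e' - e| <= 1].
have Bb : bounded_set B.
  exists (`|e| + 1); split; first exact: num_real.
  move=> M /ltW eM e' Be'; apply: le_trans eM.
  by rewrite -lerBlDl; apply: le_trans (lerB_dist _ _) _.
have [||m _ mmax] := @finite_max R _ (X `&` B) (fun e' => `|e' - e|^-1).
- exact: Xfin.
- by exists e; split => //; rewrite /B /= subrr normr0 ler01.
pose n := Num.bound (`|m - e|^-1); exists n.
apply/seteqP; split => [e' [Xe' /= ne']|_ ->]; last by split.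
have n0 : 0 < n.+1%:R :> R by rewrite ltr0n.
have le' := grid_close ne'.
have Be' : B e'.
  by rewrite /B /=; apply: le_trans (ltW le') _; rewrite invf_le1// ler1n.
apply: contrapT => /eqP; rewrite -subr_eq0 -normr_gt0 => p.
have := mmax e' (conj Xe' Be'); rewrite leNgt => /negP; apply.
have := archi_boundP (x := `|m - e|^-1); rewrite invr_ge0 normr_ge0 => /(_ isT) mn.
apply: lt_trans mn _; apply: (@lt_trans _ _ n.+1%:R); first by rewrite ltr_nat.
by rewrite -[ltLHS]invrK ltf_pV2// posrE invr_gt0.
Qed.

End cells.

Lemma counting1 (T : choiceType) (R : realType) (A : set T) :
  counting A = 1%E :> \bar R <-> exists e, A = [set e].
Proof.
rewrite /counting; split => [|[e ->]]; last first.
  by rewrite asboolT ?fset_set1 ?finmap.cardfs1//; exact: finite_set1.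
case: asboolP => // fA [] /eqP; rewrite (eqr_nat R _ 1) => /finmap.cardfs1P[e Ae].
exists e; apply: fset_set_inj => //.
by rewrite fset_set1 -Ae.
Qed.

Section enumeration.
Context d (Omega : measurableType d) (R : realType) (G : Omega -> geograph R).
Hypothesis mG : measurable_fun setT G.
Implicit Types (i j : nat) (w : Omega).
Local Notation E w := (edges (G w)).

Lemma event_isolated (H : set (edge R)) : bounded_set H -> measurable H ->
  event (fun w => exists e, E w `&` H = [set e]).
Proof.
move=> bH mH; have : measurable (G @^-1` (count_edges H @^-1` [set 1%E])).
  rewrite -[X in measurable X]setTI; apply: mG => //.
  apply: sub_sigma_algebra; right; exists H => //.
  by exists [set 1%E] => //; rewrite setTI.
by apply: event_ext => w; exact: counting1.
Qed.

Definition box i : set (edge R) :=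
  if unpickle i is Some c then cell c else set0.

Definition isolates i w : Prop := exists e, E w `&` box i = [set e].

Definition isolated_edge i w : edge R :=
  xget (0, 0, (0, 0)) [set e | E w `&` box i = [set e]].

Lemma set1_injective (T : Type) (x y : T) : [set x] = [set y] -> x = y.
Proof. by move=> e; have : [set y] x by rewrite -e. Qed.

Lemma isolated_edgeP i w e : E w `&` box i = [set e] -> isolated_edge i w = e.
Proof.
move=> ie; rewrite /isolated_edge; case: xgetP => [e' _ ie'|/(_ e)//].
by apply: set1_injective; rewrite -ie.
Qed.

Lemma isolatesE i w : isolates i w -> E w `&` box i = [set isolated_edge i w].
Proof. by move=> [e ie]; rewrite (isolated_edgeP ie). Qed.

Lemma isolated_edge_in i w : isolates i w -> E w (isolated_edge i w).
Proof.
by move=> /isolatesE ie; have [] : (E w `&` box i) (isolated_edge i w) by rewrite ie.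
Qed.

Lemma measurable_box i : measurable (box i).
Proof. by rewrite /box; case: unpickle => [c|//]; exact: measurable_cell. Qed.

Lemma bounded_box i : bounded_set (box i).
Proof.
rewrite /box; case: unpickle => [c|]; first exact: bounded_cell.
by exists 0; split; [exact: num_real|move=> M _ x []].
Qed.

Lemma event_isolates i : event (isolates i).
Proof. by apply: event_isolated; [exact: bounded_box|exact: measurable_box]. Qed.

(** The isolated edge is in [D] when the intersection of its box with [D] still contains a
    single edge; only counts in bounded Borel sets are involved. *)
Lemma measurable_isolated_edge i : measurable_fun setT (isolated_edge i).
Proof.
move=> _ D mD; rewrite setTI.
have : event (fun w => (exists e, E w `&` (box i `&` D) = [set e]) /\ isolates i w \/
    ~ isolates i w /\ D (0, 0, (0, 0))).
  apply: event_or; apply: event_and; [|exact: event_isolates|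
    exact/event_not/event_isolates|exact: event_cst].
  apply: event_isolated; last by apply: measurableI => //; exact: measurable_box.
  have [M [Mr MB]] := bounded_box i; exists M; split => // x Mx y [iy _].
  exact: MB Mx _ iy.
apply: event_ext => w; split; last first.
  rewrite /preimage /=.
  have [iw|niw] := pselect (isolates i w); last first.
    rewrite /isolated_edge; case: xgetP => [e _ ie|_ D0]; last by right.
    by case: niw; exists e.
  move=> Dp; left; split => //; exists (isolated_edge i w).
  by rewrite setIA (isolatesE iw); apply/seteqP; split => [e []|_ ->].
case=> [[[e ie] iw]|[niw D0]] /=.
  have [[Ee be] De] : ((E w `&` box i) `&` D) e by rewrite -setIA ie.
  rewrite /preimage/=; suff -> : isolated_edge i w = e by [].
  have : [set isolated_edge i w] e by rewrite -(isolatesE iw).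
  by move=> ->.
by rewrite /preimage /= /isolated_edge; case: xgetP => // e _ ie; case: niw; exists e.
Qed.

Lemma edges_locally_finite w D : bounded_set D -> finite_set (E w `&` D).
Proof.
move=> bD; have b1 : bounded_set (fst @` D).
  have [M [Mr MB]] := bD; exists M; split => // x Mx _ [e De <-].
  by apply: le_trans (MB _ Mx _ De); rewrite [leRHS]prod_normE le_max lexx.
have b2 : bounded_set (snd @` D).
  have [M [Mr MB]] := bD; exists M; split => // x Mx _ [e De <-].
  by apply: le_trans (MB _ Mx _ De); rewrite [leRHS]prod_normE le_max lexx orbT.
have := finite_setX (@vertices_locally_finite _ (G w) _ b1)
  (@vertices_locally_finite _ (G w) _ b2).
apply: sub_finite_set => e [Ee De]; have [V1 V2] := @edges_vertices _ (G w) _ Ee.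
by split; split => //; exists e.
Qed.

Lemma exists_isolating_box w e : E w e -> exists i, isolates i w /\ isolated_edge i w = e.
Proof.
move=> Ee; have [n ne] := cell_isolates (@edges_locally_finite w) Ee.
exists (pickle (n, grid n e)); have be : E w `&` box (pickle (n, grid n e)) = [set e].
  by rewrite /box pickleK.
by split; [exists e|exact: isolated_edgeP].
Qed.

(** Quantifying over edges is quantifying over the indices of the boxes that isolate an
    edge. Predicates of edges are tested on arbitrary measurable random edges, which
    allows nested quantifiers. *)
Lemma event_ex_edge (Q : Omega -> edge R -> Prop) :
  (forall a : Omega -> edge R, measurable_fun setT a -> event (fun w => Q w (a w))) ->
  event (fun w => exists2 e, E w e & Q w e).
Proof.
move=> mQ.
apply: event_ext (event_ex (F := fun i w => isolates i w /\ Q w (isolated_edge i w)) _).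
  move=> w; split => [[i [iw Qi]]|[e /exists_isolating_box[i [iw <-]] Qe]]; last by exists i.
  by exists (isolated_edge i w) => //; exact: isolated_edge_in.
move=> i; apply: event_and; first exact: event_isolates.
exact/mQ/measurable_isolated_edge.
Qed.

Lemma event_all_edge (Q : Omega -> edge R -> Prop) :
  (forall a : Omega -> edge R, measurable_fun setT a -> event (fun w => Q w (a w))) ->
  event (fun w => forall e, E w e -> Q w e).
Proof.
move=> mQ; apply: event_ext (event_not (event_ex_edge (Q := fun w e => ~ Q w e) _)).
  move=> w; split=> [h e Ee|h [e Ee]]; last by apply; exact: h.
  by apply: contrapT => nQ; apply: h; exists e.
by move=> a ma; exact/event_not/mQ.
Qed.

(** An edge is isolated by many boxes; counting requires a single index for each. *)
Definition first_index i w : Prop := isolates i w /\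
  forall j : 'I_i, isolates j w -> isolated_edge j w <> isolated_edge i w.

Lemma event_first_index i : event (first_index i).
Proof.
apply: event_and; first exact: event_isolates.
apply: event_all => j; apply: event_imp; first exact: event_isolates.
by apply/event_not/event_eq_edge; exact: measurable_isolated_edge.
Qed.

Lemma first_index_bij w (Q : set (edge R)) :
  set_bij [set i | first_index i w /\ Q (isolated_edge i w)] (E w `&` Q) (isolated_edge ^~ w).
Proof.
split.
- by move=> i /= [[iw _] Qi]; split => //; exact: isolated_edge_in.
- have H i j : (i < j)%N -> first_index i w -> first_index j w ->
      isolated_edge i w <> isolated_edge j w.
    by move=> ij [iw _] [_ jw]; exact: (jw (Ordinal ij)).
  move=> i j /set_mem[fi _] /set_mem[fj _] /= e; case: (ltngtP i j) => // ij.
    by case: (H _ _ ij fi fj).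
  by case: (H _ _ ij fj fi).
- move=> e [/exists_isolating_box ex Qe].
  have ex' : exists i, `[< isolates i w /\ isolated_edge i w = e >].
    by case: ex => i ?; exists i; apply/asboolP.
  case: (ex_minnP ex') => i /asboolP[iw ie] imin.
  exists i => //; split; last by rewrite ie.
  split => // j jw je; have /imin : `[< isolates j w /\ isolated_edge j w = e >].
    by apply/asboolP; rewrite je.
  by rewrite leqNgt ltn_ord.
Qed.

End enumeration.

(** * Numbers of edges *)

Section counting.
Local Open Scope ereal_scope.
Context (R : realType).
Implicit Types T U : choiceType.

Lemma countingE T (A : set T) : counting A = \esum_(e in A) 1 :> \bar R.
Proof.
rewrite /counting; case: asboolP => [fA|iA].
  rewrite esum_fset// fsbig_finite//= big_const_seq count_predT.
  by elim: (size _) => // n IH; rewrite iterS -IH -natr1 EFinD addeC.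
apply/esym/eq_infty => A0.
have [n nA0] : exists n : nat, (A0 <= n%:R)%R.
  exists (Num.bound `|A0|); apply: le_trans (ler_norm _) _.
  exact/ltW/archi_boundP.
have [B BA nB] := infinite_set_fset n iA.
apply: esum_ge; exists [set` B]; first by split => //; exact: finite_fset.
rewrite fsbig_finite//.
rewrite set_fsetK big_const_seq count_predT.
apply: (@le_trans _ _ (size B)%:R%:E).
  by rewrite lee_fin (le_trans nA0)// ler_nat.
by elim: (size _) => // k IH; rewrite iterS -natr1 EFinD addeC leeD2l.
Qed.

Lemma counting_nonneg T (A : set T) : 0 <= counting A :> \bar R.
Proof. by rewrite countingE esum_ge0. Qed.

Lemma le_counting T (A B : set T) : A `<=` B -> counting A <= counting B :> \bar R.
Proof.
move=> AB; rewrite !countingE (esumID A B)//.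
by rewrite setIC (setIidl AB) leeDl// esum_ge0.
Qed.

Lemma counting_inj T U (A : set T) (B : set U) (f : T -> U) :
  set_inj A f -> f @` A `<=` B -> counting A <= counting B :> \bar R.
Proof.
move=> fi fAB; apply: le_trans (le_counting fAB).
by rewrite !countingE esum_image.
Qed.

Lemma counting_finite T (A : set T) : counting A < +oo :> \bar R -> finite_set A.
Proof. by rewrite /counting; case: asboolP. Qed.

(** An element outside [A] would add one to a finite number. *)
Lemma subset_counting_eq T (A B : set T) : A `<=` B -> counting A = counting B :> \bar R ->
  counting B < +oo :> \bar R -> A = B.
Proof.
move=> AB e fB; apply/seteqP; split => // x Bx; apply: contrapT => nAx.
have : counting A + 1 <= counting B :> \bar R.
  rewrite !countingE (esumID A B)// setIC (setIidl AB) leeD2l//.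
  have : counting [set x] <= counting (B `&` ~` A) :> \bar R.
    by apply: le_counting => _ ->.
  by rewrite !countingE esum_set1.
have := counting_nonneg A; rewrite e; case: (counting B) fB => // r _ _.
by rewrite lee_fin gerDl ler10.
Qed.

(** Choosing a preimage of each element of [B] gives a subset of [A] with as many
    elements, hence [A] itself. *)
Lemma counting_surj T U (A : set T) (B : set U) (f : T -> U) :
  B `<=` f @` A -> counting A = counting B :> \bar R ->
  counting B < +oo :> \bar R -> set_inj A f.
Proof.
move=> BA e fB x x' /set_mem Ax /set_mem Ax' fxx'.
pose g y := xget x [set t | A t /\ f t = y].
have gB y : B y -> A (g y) /\ f (g y) = y.
  by move=> /BA[t At ty]; rewrite /g; case: xgetP => [t' _ //|/(_ t)[]].
have gA : g @` B = A.
  apply: (@subset_counting_eq _ (g @` B) A); last by rewrite e.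
    by move=> _ [y /gB[Ag _] <-].
  rewrite e !countingE esum_image// => y y' /set_mem By /set_mem By' gy.
  by rewrite -(gB _ By).2 gy (gB _ By').2.
have [y By yx] : (g @` B) x by rewrite gA.
have [y' By' yx'] : (g @` B) x' by rewrite gA.
by rewrite -yx -yx' -(gB _ By).2 -(gB _ By').2 yx yx' fxx'.
Qed.

Lemma counting_partition T (A : set T) (J : nat -> set T) :
  trivIset setT J -> A = \bigcup_n J n ->
  counting A = \sum_(n <oo) counting (J n) :> \bar R.
Proof.
move=> tJ ->; rewrite countingE esum_bigcupT// -nneseries_esumT//; last first.
  by move=> n; rewrite esum_ge0.
by apply: eq_eseriesr => n _; rewrite countingE.
Qed.

End counting.

Lemma counting_surj_le (R : realType) (T U : choiceType) (x0 : T)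
    (A : set T) (B : set U) (f : T -> U) :
  B `<=` f @` A -> (counting B <= counting A :> \bar R)%E.
Proof.
move=> BA; pose g y := xget x0 [set t | A t /\ f t = y].
have gB y : B y -> A (g y) /\ f (g y) = y.
  by move=> /BA[t At ty]; rewrite /g; case: xgetP => [t' _ //|/(_ t)[]].
apply: (@counting_inj _ _ _ _ _ g) => [y y' /set_mem By /set_mem By' gy|].
  by rewrite -(gB _ By).2 gy (gB _ By').2.
by move=> _ [y /gB[Ag _] <-].
Qed.

Section edge_counts.
Local Open Scope ereal_scope.
Context d (Omega : measurableType d) (R : realType) (G : Omega -> geograph R).
Hypothesis mG : measurable_fun setT G.
Local Notation E w := (edges (G w)).

Definition edge_event (Q : Omega -> edge R -> Prop) : Prop :=
  forall a : Omega -> edge R, measurable_fun setT a -> event (fun w => Q w (a w)).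

Definition number (Q : Omega -> edge R -> Prop) w : \bar R :=
  counting (E w `&` [set e | Q w e]).

Lemma number_ge0 Q w : 0 <= number Q w.
Proof. exact: counting_nonneg. Qed.

Lemma numberE Q w : number Q w =
  \sum_(i <oo) (\1_[set w | first_index G i w /\ Q w (isolated_edge G i w)] w)%:E.
Proof.
rewrite /number countingE (reindex_esum _ _ _ _ (first_index_bij G w [set e | Q w e])).
rewrite (esum_mkcond).
rewrite nneseries_esumT; last by move=> n; rewrite lee_fin.
apply: eq_esum => i _; rewrite indicE; case: ifPn.
  by move=> /set_mem h; rewrite mem_set.
by move=> /negP h; rewrite memNset// => h'; apply: h; exact: mem_set.
Qed.

Lemma measurable_number Q : edge_event Q -> measurable_fun setT (number Q).
Proof.
move=> mQ; apply: (eq_measurable_fun (fun w => \sum_(i <oo)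
  (\1_[set w | first_index G i w /\ Q w (isolated_edge G i w)] w)%:E)).
  by move=> w _; rewrite numberE.
apply: ge0_emeasurable_sum => [i w _ _|i _]; first by rewrite lee_fin.
apply/measurable_EFinP/measurable_indic.
apply: event_and; first exact: event_first_index.
exact/mQ/measurable_isolated_edge.
Qed.

End edge_counts.

(** * Translations *)

Definition shift (R : realType) (s : plane R) (e : edge R) : edge R :=
  (s + e.1, s + e.2).

Section equivariance.
Variables (R : realType) (s : plane R) (E E' : set (edge R)).
Hypothesis EE' : forall e, E' (shift s e) <-> E e.
Implicit Types (e : edge R) (h : R).

Lemma shiftK e : shift s (shift (- s) e) = e.
Proof. by case: e => u v; rewrite /shift /= !addNKr. Qed.

Lemma shift_inj : injective (shift s).
Proof.
move=> [u v] [u' v'] e; have /addrI /= -> := congr1 fst e.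
by have /addrI /= -> := congr1 snd e.
Qed.

Lemma ex_shift (Q : edge R -> Prop) :
  (exists2 e, E' e & Q e) <-> (exists2 e, E e & Q (shift s e)).
Proof.
split=> [[e E'e Qe]|[e Ee Qe]]; last by exists (shift s e); rewrite ?EE'.
by exists (shift (- s) e); rewrite ?shiftK// -EE' shiftK.
Qed.

Lemma all_shift (Q : edge R -> Prop) :
  (forall e, E' e -> Q e) <-> (forall e, E e -> Q (shift s e)).
Proof.
split=> [h e Ee|h e E'e]; first by apply: h; rewrite EE'.
by rewrite -(shiftK e); apply: h; rewrite -EE' shiftK.
Qed.

Lemma forward_shift n e e' : forward E' n (shift s e) (shift s e') <-> forward E n e e'.
Proof.
elim: n e => [|n IH] e /=; first by split => [/shift_inj|->].
rewrite ex_shift; split=> -[e1 Ee1 [h /IH f]]; exists e1 => //; split => //.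
  exact: addrI h.
by rewrite /= h.
Qed.

Lemma has_ancestor_shift n e : has_ancestor E' n (shift s e) <-> has_ancestor E n e.
Proof.
elim: n e => [//|n IH] e /=.
rewrite ex_shift; split=> -[e1 Ee1 [h /IH f]]; exists e1 => //; split => //.
  exact: addrI h.
by rewrite /= h.
Qed.

Lemma backward_infinite_shift e : backward_infinite E' (shift s e) <-> backward_infinite E e.
Proof. by split => h n; have := h n; rewrite has_ancestor_shift. Qed.

Lemma same_tree_shift e e' : same_tree E' (shift s e) (shift s e') <-> same_tree E e e'.
Proof.
split=> -[n [m h]]; exists n, m; move: h; rewrite ex_shift => -[e1 Ee1].
  by rewrite !forward_shift; exists e1.
by move=> h; exists e1; rewrite ?forward_shift.
Qed.

Lemma exit_edge_shift h e : exit_edge E' (s.2 + h) (shift s e) <-> exit_edge E h e.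
Proof.
rewrite /exit_edge /= lerD2l; split=> -[eh H]; split => // n.
  move=> e' Ee' f; have := H n (shift s e').
  by rewrite /= ltrD2l EE' forward_shift; apply.
rewrite all_shift => e' Ee'; rewrite forward_shift /= ltrD2l.
exact: H.
Qed.

Lemma crossing_x_shift h e : crossing_x (s.2 + h) (shift s e) = s.1 + crossing_x h e.
Proof.
rewrite /crossing_x /abscissa /= -addrA; congr (_ + (_ + _)).
by congr (_ / _ * _); rewrite opprD addrACA subrr add0r.
Qed.

Lemma crossing_shift h e : crossing (s.2 + h) (shift s e) <-> crossing h e.
Proof. by rewrite /crossing /= lerD2l ltrD2l. Qed.

Lemma rightmost_shift h e : rightmost E' (s.2 + h) (shift s e) <-> rightmost E h e.
Proof.
rewrite /rightmost exit_edge_shift; split=> -[xe H]; split => //.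
  move=> e' Ee' [xe' ee']; have := H (shift s e').
  rewrite EE' exit_edge_shift same_tree_shift.
  by rewrite !crossing_x_shift lerD2l; apply.
rewrite all_shift => e' Ee'; rewrite exit_edge_shift same_tree_shift !crossing_x_shift lerD2l.
exact: H.
Qed.

End equivariance.

Section path_events.
Context d (Omega : measurableType d) (R : realType) (G : Omega -> geograph R).
Hypothesis mG : measurable_fun setT G.
Local Notation E w := (edges (G w)).
Variables (a b : Omega -> edge R).
Hypotheses (ma : measurable_fun setT a) (mb : measurable_fun setT b).

Lemma event_forward n : event (fun w => forward (E w) n (a w) (b w)).
Proof.
elim: n a ma => [|n IH] c mc /=; first exact: event_eq_edge.
apply: (event_ex_edge mG (Q := fun w e1 => e1.1 = (c w).2 /\ forward (E w) n e1 (b w))).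
move=> e1 m1; apply: event_and; last exact: IH.
by apply: event_eq_plane; [exact: measurable_source|exact: measurable_target].
Qed.

Lemma event_has_ancestor n : event (fun w => has_ancestor (E w) n (a w)).
Proof.
elim: n a ma => [|n IH] c mc /=; first exact: event_cst.
apply: (event_ex_edge mG (Q := fun w e1 => e1.2 = (c w).1 /\ has_ancestor (E w) n e1)).
move=> e1 m1; apply: event_and; last exact: IH.
by apply: event_eq_plane; [exact: measurable_target|exact: measurable_source].
Qed.

End path_events.

Section tree_events.
Context d (Omega : measurableType d) (R : realType) (G : Omega -> geograph R).
Hypothesis mG : measurable_fun setT G.
Local Notation E w := (edges (G w)).
Variables (a b : Omega -> edge R).
Hypotheses (ma : measurable_fun setT a) (mb : measurable_fun setT b).

Lemma event_backward_infinite : event (fun w => backward_infinite (E w) (a w)).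
Proof. by apply: event_all => n; exact: event_has_ancestor. Qed.

Lemma event_same_tree : event (fun w => same_tree (E w) (a w) (b w)).
Proof.
do 2! (apply: event_ex => ?).
by apply: (event_ex_edge mG) => c mc; apply: event_and; exact: event_forward.
Qed.

Lemma event_exit_edge h : event (fun w => exit_edge (E w) h (a w)).
Proof.
apply: event_and; first by apply: event_le => //; exact: measurable_source_y.
apply: event_all => n; apply: (event_all_edge mG) => c mc.
apply: event_imp; first exact: event_forward.
by apply: event_lt => //; exact: measurable_target_y.
Qed.

Lemma event_crossing h : event (fun w => crossing h (a w)).
Proof.
apply: (event_ext (S := fun w => (a w).1.2 <= h /\ h < (a w).2.2)).
  by move=> w; split => /andP.
apply: event_and; [apply: event_le|apply: event_lt] => //.
  exact: measurable_source_y.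
exact: measurable_target_y.
Qed.

End tree_events.

Section rightmost_events.
Context d (Omega : measurableType d) (R : realType) (G : Omega -> geograph R).
Hypothesis mG : measurable_fun setT G.
Local Notation E w := (edges (G w)).
Variables (a : Omega -> edge R).
Hypotheses (ma : measurable_fun setT a).

Lemma event_rightmost h : event (fun w => rightmost (E w) h (a w)).
Proof.
apply: event_and; first exact: event_exit_edge.
apply: (event_all_edge mG) => c mc; apply: event_imp.
  by apply: event_and; [exact: event_exit_edge|exact: event_same_tree].
by apply: event_le; exact: measurable_crossing_x.
Qed.

End rightmost_events.

(** * Means and mass transport *)

Section transport.
Context d (Omega : measurableType d) (R : realType).
Variables (P : probability Omega R) (G : Omega -> geograph R).
Variable theta : plane R -> Omega -> Omega.
Hypothesis mG : measurable_fun setT G.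
Hypothesis act : ergodic_action P theta.
Hypothesis stat : forall s w, G (theta s w) = translate s (G w).
Local Notation E w := (edges (G w)).
Implicit Types (s : plane R) (Q : Omega -> edge R -> Prop).

Lemma edges_theta s w e : E (theta s w) (shift s e) <-> E w e.
Proof.
rewrite stat /=; split => [[e' Ee' e'e]|Ee]; last by exists e.
by have -> : e = e' by apply: (@shift_inj R s).
Qed.

Lemma measurable_theta s : measurable_fun setT (theta s).
Proof.
have := measurableT_comp (action_measurable act) (pair1_measurable s).
exact.
Qed.

Lemma theta_event s (A : Omega -> Prop) : event A -> event (fun w => A (theta s w)).
Proof.
by move=> mA; rewrite /event -[X in measurable X]setTI; exact: measurable_theta.
Qed.

Lemma number_theta s Q w :
  number G Q (theta s w) = number G (fun w e => Q (theta s w) (shift s e)) w.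
Proof.
rewrite /number !countingE -[RHS](@esum_image R _ _ _ (shift s) (fun=> 1%E)).
  congr esum; apply/seteqP; split => [e [Ee /= Qe]|_ [e [Ee /= Qe] <-]].
    exists (shift (- s) e); rewrite ?shiftK//; split; rewrite /= ?shiftK//.
    by rewrite -(edges_theta s) shiftK.
  by split => //; rewrite edges_theta.
by move=> x y _ _; exact: shift_inj.
Qed.

Definition mean Q : \bar R := (\int[P]_w number G Q w)%E.

Lemma mean_theta s Q : edge_event Q ->
  mean (fun w e => Q (theta s w) (shift s e)) = mean Q.
Proof.
move=> mQ; rewrite /mean.
transitivity (\int[P]_w (number G Q \o theta s) w)%E.
  by apply: eq_integral => w _; rewrite /= number_theta.
have := @ge0_integral_pushforward _ _ _ _ R _ (measurable_theta s) P setT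
  (number G Q) measurableT (measurable_number mG mQ).
rewrite preimage_setT => <-; last by move=> w _; exact: number_ge0.
apply: eq_measure_integral; [exact: measurable_theta|move=> mt A mA _].
exact: (action_preserving act).
Qed.

Lemma mean_ext Q Q' : (forall w e, E w e -> Q w e <-> Q' w e) -> mean Q = mean Q'.
Proof.
move=> QQ'; apply: eq_integral => w _; rewrite /number; congr counting.
by apply/seteqP; split => e [Ee /= /(QQ' _ _ Ee)].
Qed.

Section partition.
Variables (K : countType) (F : Omega -> edge R -> K -> Prop).

Lemma mean_partition Q : edge_event Q -> (forall k, edge_event (fun w e => F w e k)) ->
    (forall w e, E w e -> Q w e -> exists! k, F w e k) ->
  mean Q = (\sum_(n <oo) mean (fun w e => Q w e /\
    (if @pickle_inv K n is Some k then F w e k else False)))%E.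
Proof.
move=> mQ mF uF; rewrite /mean -integral_nneseries//; last first.
  move=> n; apply: measurable_number => // a ma; apply: event_and; first exact: mQ.
  by case: pickle_inv => [k|]; [exact: mF|exact: event_cst].
apply: eq_integral => w _; apply: counting_partition.
  move=> n m _ _ [e [[Ee [Qe en]] [_ [_ em]]]].
  have [k [_ ku]] := uF _ _ Ee Qe.
  have idx i : (if pickle_inv i is Some k' then F w e k' else False) -> pickle k = i.
    by have := @pickle_invK K i; case: pickle_inv => [k' /= <-|//] /ku ->.
  by rewrite -(idx n en) -(idx m em).
apply/seteqP; split => [e [Ee Qe]|e [n _ [Ee [Qe _]]]]; last by [].
have [k [Fk _]] := uF _ _ Ee Qe.
by exists (pickle k) => //; split => //; split => //; rewrite pickleK_inv.
Qed.

End partition.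

(** Each edge satisfying [Q] sends a unit mass from the cell given by [F] to the cell given by
    [H]. The cells are indexed by [K], on which the translations [vec k] act; the group
    law is only used through [zero] and [neg], in the form of the hypotheses on [F]
    and [H]. *)
Section mass_transport.
Variables (K : countType) (zero : K) (neg : K -> K) (vec : K -> plane R).
Hypothesis negK : involutive neg.
Variables (Q : Omega -> edge R -> Prop) (F H : Omega -> edge R -> K -> Prop).
Hypotheses (mQ : edge_event Q) (mF : forall k, edge_event (fun w e => F w e k))
  (mH : forall k, edge_event (fun w e => H w e k)).
Hypotheses (uF : forall w e, E w e -> Q w e -> exists! k, F w e k)
  (uH : forall w e, E w e -> Q w e -> exists! k, H w e k).
Hypothesis Q_theta : forall k w e,
  Q (theta (vec k) w) (shift (vec k) e) <-> Q w e.
Hypothesis F_theta : forall k w e,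
  F (theta (vec k) w) (shift (vec k) e) zero <-> F w e (neg k).
Hypothesis H_theta : forall k w e,
  H (theta (vec k) w) (shift (vec k) e) k <-> H w e zero.

(** The mass sent from cell [zero] to cell [k] has the same mean as that sent from cell
    [neg k] to cell [zero]; it remains to sum over [k]. *)
Lemma mass_transport :
  mean (fun w e => Q w e /\ F w e zero) = mean (fun w e => Q w e /\ H w e zero).
Proof.
have mand Q1 Q2 : edge_event Q1 -> edge_event Q2 -> edge_event (fun w e => Q1 w e /\ Q2 w e).
  by move=> m1 m2 a ma; apply: event_and; [exact: m1|exact: m2].
rewrite (@mean_partition K H); [|exact: mand|exact: mH|]; last first.
  by move=> w e Ee [Qe _]; exact: uH.
rewrite [RHS](@mean_partition K (fun w e k => F w e (neg k))); first last.
- move=> w e Ee [Qe _]; have [k [Fk ku]] := uF Ee Qe.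
  exists (neg k); split; first by rewrite negK.
  by move=> k' /ku ->; rewrite negK.
- by move=> k; exact: mF.
- exact: mand.
apply: eq_eseriesr => n _; case: pickle_inv => [k|]; last first.
  by apply: mean_ext => w e _; split => -[].
rewrite -(mean_theta (vec k)); last exact: mand (mand _ _ _ _) _.
apply: mean_ext => w e _; rewrite Q_theta F_theta H_theta.
by split => [[[? ?] ?]|[[? ?] ?]].
Qed.

End mass_transport.

End transport.

(** The nonnegative difference has integral zero. *)
Lemma ae_eq_of_le d (Omega : measurableType d) (R : realType)
    (P : probability Omega R) (f g : Omega -> \bar R) :
    measurable_fun setT f -> measurable_fun setT g ->
    (forall w, 0 <= f w)%E -> (forall w, 0 <= g w)%E ->
    {ae P, forall w, f w <= g w}%E ->
    (\int[P]_w g w < +oo)%E -> (\int[P]_w f w = \int[P]_w g w)%E ->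
  {ae P, forall w, f w = g w /\ (g w < +oo)%E}.
Proof.
move=> mf mg f0 g0 fg gfin fgE.
have intg : P.-integrable setT g.
  apply/integrableP; split => //.
  by under eq_integral do rewrite gee0_abs//.
have intf : P.-integrable setT f.
  apply/integrableP; split => //.
  by under eq_integral do rewrite gee0_abs//; rewrite fgE.
have aef := integrable_ae measurableT intf.
have aeg := integrable_ae measurableT intg.
have : (\int[P]_w `|(g \- f) w| = 0)%E.
  transitivity (\int[P]_w ((g \- f) w))%E.
    apply: ae_eq_integral => //.
    - apply: measurableT_comp => //; exact: emeasurable_funB.
    - exact: emeasurable_funB.
    - move: fg aef aeg; apply: filterS3 => w fgw /(_ Logic.I) fw /(_ Logic.I) gw _ /=.
      by rewrite gee0_abs// sube_ge0// fw.
  rewrite integralB// fgE subee//; apply: (integrable_fin_num measurableT) => //.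
move/(ae_eq_integral_abs _ measurableT) => /(_ (emeasurable_funB mg mf)) ae0.
move: ae0 aef aeg; apply: filterS3 => w /(_ Logic.I) /= fw /(_ Logic.I) ff /(_ Logic.I) gf.
split; last by rewrite ltey_eq gf.
move: ff gf fw; case: (f w) => // x _; case: (g w) => // y _ [] /eqP.
by rewrite subr_eq0 => /eqP ->.
Qed.

(** The larger function need not be measurable: the integral of a nonnegative function is
    a supremum over the simple functions below it. *)
Lemma le_integral_ge0 d (Omega : measurableType d) (R : realType)
    (mu : {measure set Omega -> \bar R}) (f g : Omega -> \bar R) :
  (forall w, 0 <= f w)%E -> (forall w, f w <= g w)%E ->
  (\int[mu]_w f w <= \int[mu]_w g w)%E.
Proof.
move=> f0 fg; have g0 w : (0 <= g w)%E by exact: le_trans (f0 w) (fg w).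
rewrite !ge0_integralTE//.
by apply: le_ereal_sup => _ [h hf <-]; exists h => // w; exact: le_trans (hf w) (fg w).
Qed.

Section almost_sure.
Context d (Omega : measurableType d) (R : realType) (P : probability Omega R).

Lemma ae_all (K : countType) (A : K -> Omega -> Prop) :
  (forall k, {ae P, forall w, A k w}) -> {ae P, forall w, forall k, A k w}.
Proof.
move=> h; have := @ae_foralln _ Omega R P
  (fun n w => if @pickle_inv K n is Some k then A k w else True).
move=> /(_ _)/wrap[|]; first by move=> n; case: pickle_inv => [k|]; [exact: h|exact: aeW].
by apply: filterS => w hw k; have := hw (pickle k); rewrite pickleK_inv.
Qed.

Lemma ae_false : ~ {ae P, forall w : Omega, False}.
Proof.
move=> [N [mN N0 subN]]; have : P setT = 0%E.
  by rewrite -N0; congr (P _); apply/seteqP; split => // w _; apply: subN.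
by rewrite probability_setT => -[] /eqP; rewrite oner_eq0.
Qed.

Variable theta : plane R -> Omega -> Omega.
Hypothesis act : ergodic_action P theta.

Lemma ae_theta s (A : Omega -> Prop) :
  {ae P, forall w, A w} -> {ae P, forall w, A (theta s w)}.
Proof.
move=> [N [mN N0 subN]]; exists (theta s @^-1` N); split.
- exact: (theta_event act).
- by rewrite (action_preserving act).
- by move=> w nA; exact: subN.
Qed.

End almost_sure.

(** * Extreme members of stationary families *)

Section recurrence.
Context d (Omega : measurableType d) (R : realType).
Variables (P : probability Omega R) (G : Omega -> geograph R).
Variable theta : plane R -> Omega -> Omega.
Hypothesis mG : measurable_fun setT G.
Hypothesis act : ergodic_action P theta.
Hypothesis stat : forall s w, G (theta s w) = translate s (G w).
Local Notation E w := (edges (G w)).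
Variables (Q : Omega -> edge R -> Prop) (f : edge R -> int) (vec : int -> plane R).
Hypotheses (mQ : edge_event Q) (mf : forall k, @edge_event _ Omega R (fun _ e => f e = k)).
Hypothesis Q_theta : forall k w e,
  Q (theta (vec k) w) (shift (vec k) e) <-> Q w e.
Hypothesis f_shift : forall k e, f (shift (vec k) e) = f e + k.

Let top k w := (exists2 e, E w e & Q w e /\ f e = k) /\
  (forall e, E w e -> Q w e -> f e <= k).

Let event_top k : event (top k).
Proof.
apply: event_and.
  by apply: (event_ex_edge mG) => a ma; apply: event_and; [exact: mQ|exact: mf].
apply: (event_all_edge mG) => a ma; apply: event_imp; first exact: mQ.
apply: (event_ext (S := fun w => exists j, f (a w) = j /\ j <= k)).
  by move=> w; split => [[j [<-]]|]//; exists (f (a w)).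
by apply: event_ex => j; apply: event_and; [exact: mf|exact: event_cst].
Qed.

Let top_theta k w : top k (theta (vec k) w) <-> top 0 w.
Proof.
have EE := edges_theta stat (vec k) w.
rewrite /top (ex_shift EE) (all_shift EE); split=> -[[e Ee [Qe fe]] H]; split.
- by exists e => //; rewrite -Q_theta; split; eauto; move: fe; rewrite f_shift; lia.
- by move=> e' Ee' Qe'; have := H _ Ee'; rewrite Q_theta f_shift => /(_ Qe'); lia.
- by exists e => //; rewrite Q_theta f_shift fe add0r.
- by move=> e' Ee'; rewrite Q_theta f_shift => /(H _ Ee'); lia.
Qed.

(** The events [top j] are disjoint and have the same probability. *)
Lemma no_top k : P [set w | top k w] = 0%E.
Proof.
have Pk j : P [set w | top j w] = P [set w | top 0 w].
  rewrite -(action_preserving act (vec j) (event_top j)); congr (P _).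
  by apply/seteqP; split => w /= h; apply/(top_theta j w).
rewrite Pk.
have fin : P [set w | top 0 w] \is a fin_num by exact: (fin_num_measure P _ (event_top 0)).
rewrite -(fineK fin); set c := fine _.
have c0 : 0 <= c by rewrite fine_ge0.
pose F (i : nat) : set Omega := [set w | top i%:Z w].
have mF i : measurable (F i) by exact: event_top.
have tF : trivIset setT F.
  move=> i j _ _ [w [[[e Ee [Qe fe]] H] [[e' Ee' [Qe' fe']] H']]].
  by have := H _ Ee' Qe'; have := H' _ Ee Qe; rewrite fe fe'; lia.
have H n : n%:R * c <= 1.
  have mU : measurable (\big[setU/set0]_(i < n) F i).
    by apply: bigsetU_measurable => i _; exact: mF.
  have := probability_le1 P mU; rewrite measure_bigsetU//.
  have -> : (\sum_(i < n) P (F i) = \sum_(i < n) c%:E)%E.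
    by apply: eq_bigr => i _; rewrite [LHS]Pk fineK.
  by rewrite sumEFin big_const cardT size_enum_ord iter_addr addr0 lee_fin mulr_natl.
congr (_%:E); apply/eqP; rewrite eq_le c0 andbT leNgt; apply/negP => cp.
have := archi_boundP (x := c^-1); rewrite invr_ge0 => /(_ c0).
set n := Num.bound _ => cn; have := H n; rewrite leNgt => /negP; apply.
by rewrite -ltr_pdivrMr// mul1r.
Qed.

Lemma unbounded_above : {ae P, forall w, (exists2 e, E w e & Q w e) ->
  forall k, exists2 e, E w e & Q w e /\ k <= f e}.
Proof.
have : {ae P, forall w, forall k, ~ top k w}.
  apply: ae_all => k; exists [set w | top k w]; split => //.
  - exact: event_top.
  - exact: no_top.
  - by move=> w /= /contrapT.
apply: filterS => w nt [e Ee Qe] k; apply: contrapT => nk.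
have ub e' : E w e' -> Q w e' -> f e' < k.
  move=> Ee' Qe'; rewrite ltNge; apply/negP => kf; apply: nk; by exists e'.
pose A n := `[< exists2 e', E w e' & Q w e' /\ f e' = k - n%:Z >].
have exA : exists n, A n.
  exists (absz (k - f e)%R); apply/asboolP; exists e => //; split => //.
  by have := ub _ Ee Qe; lia.
case: (ex_minnP exA) => n /asboolP[e' Ee' [Qe' fe']] nmin.
apply: (nt (k - n%:Z)); split; first by exists e'.
move=> e1 Ee1 Qe1; have := ub _ Ee1 Qe1 => lt1.
have /nmin : A (absz (k - f e1)%R) by apply/asboolP; exists e1 => //; split => //; lia.
by lia.
Qed.

End recurrence.

(** * Stationary forests *)

Section stationary_forest.
Context d (Omega : measurableType d) (R : realType).
Variables (P : probability Omega R) (G : Omega -> geograph R).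
Variable theta : plane R -> Omega -> Omega.
Hypothesis mG : measurable_fun setT G.
Hypothesis act : ergodic_action P theta.
Hypothesis stat : forall s w, G (theta s w) = translate s (G w).
Hypothesis intensityG : (edge_intensity P G < +oo)%E.
Local Notation E w := (edges (G w)).
Local Notation EE := (edges_theta stat).

(** The only use of the finite edge intensity. *)
Lemma unit_square_mean (Q : Omega -> edge R -> Prop) :
  (forall w e, E w e -> Q w e ->
     segment e.1 e.2 `&` (`[0, 1] `*` `[0, 1]) !=set0) ->
  (mean P G Q < +oo)%E.
Proof.
move=> HQ; apply: le_lt_trans intensityG; apply: le_integral_ge0 => w.
  exact: number_ge0.
apply: le_counting => e [Ee Qe]; split => //; exact: HQ Qe.
Qed.

Lemma number_fin (Q : Omega -> edge R -> Prop) : edge_event Q ->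
  (mean P G Q < +oo)%E -> {ae P, forall w, finite_set (E w `&` [set e | Q w e])}.
Proof.
move=> mQ fin; have : P.-integrable setT (number G Q).
  apply/integrableP; split; first exact: measurable_number.
  by under eq_integral do rewrite gee0_abs ?number_ge0//.
move=> /(integrable_ae measurableT); apply: filterS => w /(_ I) fw.
by apply: (@counting_finite R); rewrite ltey_eq; apply/orP; left.
Qed.

Lemma floor0_itv (x : R) : Num.floor x = 0 -> x \in `[0, 1].
Proof.
by move=> x0; have := floor_itv x; rewrite x0 add0r in_itv/= => /andP[-> /ltW ->].
Qed.

Lemma floorDl (m : int) (x : R) : Num.floor (m%:~R + x) = m + Num.floor x.
Proof. by rewrite floorDzr ?intr_int// intrKfloor. Qed.

Definition lattice_vector (k l : int) : plane R := (k%:~R, l%:~R).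

Lemma lattice_vectorN k l : lattice_vector (- k) (- l) = - lattice_vector k l.
Proof. by rewrite /lattice_vector !intrN. Qed.

Definition crosses_at (h : R) (k : int) (e : edge R) : Prop :=
  crossing h e /\ Num.floor (crossing_x h e) = k.

Lemma event_crosses_at h k : edge_event (fun (_ : Omega) => crosses_at h k).
Proof.
move=> a ma; apply: event_and; first exact: event_crossing.
by apply: event_floor; exact: measurable_crossing_x.
Qed.

Lemma crosses_at_shift (s : plane R) (l : int) (h : R) k e : s.1 = l%:~R ->
  crosses_at (s.2 + h) (l + k) (shift s e) <-> crosses_at h k e.
Proof.
move=> sl; rewrite /crosses_at crossing_shift crossing_x_shift sl floorDl.
by split=> -[ce xk]; split => //; lia.
Qed.

Lemma mean_crosses_fin h : (mean P G (fun _ => crosses_at h 0) < +oo)%E.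
Proof.
rewrite -(mean_theta mG act stat (0%:~R, h) (event_crosses_at h 0)).
rewrite (_ : mean P G _ = mean P G (fun _ => crosses_at 0 0)); last first.
  apply: mean_ext => w e _; have := @crosses_at_shift (0%:~R, h) 0 0 0 e erefl.
  by rewrite !addr0.
apply: unit_square_mean => w e Ee [ce x0]; exists (crossing_x 0 e, 0); split.
  exact: (crossing_x_segment ce).
by split => /=; [exact: floor0_itv|rewrite in_itv/= lexx ler01].
Qed.

Lemma ae_crossing_finite : {ae P, forall w, crossing_finite (E w)}.
Proof.
have fin0 := number_fin (event_crosses_at 0 0) (mean_crosses_fin 0).
have : {ae P, forall w, forall hk : int * int,
    finite_set (E (theta (lattice_vector (- hk.2) (- hk.1)) w) `&`
                [set e | crosses_at 0 0 e])}.
  by apply: ae_all => hk;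
    exact: (ae_theta act (lattice_vector (- hk.2) (- hk.1)) fin0).
apply: filterS => w H h k.
apply: (sub_finite_set _ (finite_image (shift (lattice_vector k h)) (H (h, k)))).
move=> e [Ee ce]; exists (shift (lattice_vector (- k) (- h)) e).
  split; first exact/EE.
  have /(@crosses_at_shift (lattice_vector (- k) (- h)) (- k) _ _ _ erefl) := ce.
  by rewrite addNr [(lattice_vector _ _).2]/= intrN addNr.
by rewrite lattice_vectorN shiftK.
Qed.

Definition in_cell (k : int * int) (u : plane R) : Prop :=
  Num.floor u.1 = k.1 /\ Num.floor u.2 = k.2.

Lemma in_cell_shift (l k : int * int) u :
  in_cell (l.1 + k.1, l.2 + k.2) (lattice_vector l.1 l.2 + u) <-> in_cell k u.
Proof. by rewrite /in_cell /= !floorDl; split=> -[? ?]; split; lia. Qed.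

Lemma event_in_cell k (u : Omega -> plane R) : measurable_fun setT u ->
  event (fun w => in_cell k (u w)).
Proof.
move=> mu; apply: event_and; apply: event_floor.
  exact: (measurableT_comp measurable_fst mu).
exact: (measurableT_comp measurable_snd mu).
Qed.

Lemma cell_unique u : exists! k, in_cell k u.
Proof. by exists (Num.floor u.1, Num.floor u.2); split => // -[a b] [/= -> ->]. Qed.

(** Mass transport from the source to the target of the edges with infinitely many
    ancestors. Each of them is the next edge of another one, so that the number with
    target in a unit square is at least the number with source in it. The means agree, so
    the numbers agree, and the surjection is a bijection. *)
Lemma ae_backward_infinite_unique : {ae P, forall w, upward_forest (E w)} ->
  {ae P, forall w, forall e e', E w e -> E w e' ->
     backward_infinite (E w) e -> backward_infinite (E w) e' -> e.2 = e'.2 -> e = e'}.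
Proof.
move=> aeuf.
pose Q w e := backward_infinite (E w) e.
pose Q1 w e := Q w e /\ in_cell (0, 0) e.1.
pose Q2 w e := Q w e /\ in_cell (0, 0) e.2.
have mQ : edge_event Q by move=> a ma; exact: event_backward_infinite.
have mQ1 : edge_event Q1.
  move=> a ma; apply: event_and; first exact: mQ.
  by apply: event_in_cell; exact: measurable_source.
have mQ2 : edge_event Q2.
  move=> a ma; apply: event_and; first exact: mQ.
  by apply: event_in_cell; exact: measurable_target.
have m12 : mean P G Q1 = mean P G Q2.
  apply: (@mass_transport _ _ _ P G theta mG act stat (int * int)%type (0, 0)
    (fun k => (- k.1, - k.2)) (fun k => lattice_vector k.1 k.2) _ Q
    (fun w e k => in_cell k e.1) (fun w e k => in_cell k e.2)) => //.
  - by move=> [a b]; rewrite /= !opprK.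
  - by move=> k a ma; apply: event_in_cell; exact: measurable_source.
  - by move=> k a ma; apply: event_in_cell; exact: measurable_target.
  - by move=> w e _ _; exact: cell_unique.
  - by move=> w e _ _; exact: cell_unique.
  - by move=> k w e; exact: (backward_infinite_shift (EE (lattice_vector k.1 k.2) w)).
  - move=> k w e; rewrite /shift /=.
    by rewrite -(in_cell_shift k (- k.1, - k.2) e.1) /= !addrN.
  - move=> k w e; rewrite /shift /=.
    by rewrite -(in_cell_shift k (0, 0) e.2) /= !addr0; case: k.
have fin1 : (mean P G Q1 < +oo)%E.
  apply: unit_square_mean => w e Ee [_ [/floor0_itv h1 /floor0_itv h2]].
  by exists e.1; split; [exact: segment_left|split].
have base : {ae P, forall w, forall e e', E w e -> E w e' ->
     backward_infinite (E w) e -> backward_infinite (E w) e' ->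
     e.2 = e'.2 -> in_cell (0, 0) e.2 -> e = e'}.
  have surj w : upward_forest (E w) ->
      E w `&` [set e | Q1 w e] `<=` next_edge (E w) @` (E w `&` [set e | Q2 w e]).
    move=> uf e [Ee [be ce]]; have [c Ec [ce' bc]] := backward_infinite_child uf be.
    exists c; last exact/esym/(next_edgeE uf Ec Ee (esym ce')).
    by split; [exact: Ec|split; [exact: bc|rewrite ce'; exact: ce]].
  have le12 : {ae P, forall w, number G Q1 w <= number G Q2 w}%E.
    apply: filterS aeuf => w uf; apply: counting_surj_le (surj w uf).
    exact: (0, 0, (0, 0)).
  have := @ae_eq_of_le _ Omega R P _ _ (measurable_number mG mQ1)
    (measurable_number mG mQ2) (number_ge0 G Q1) (number_ge0 G Q2) le12.
  rewrite -/(mean P G Q1) -/(mean P G Q2) -m12 => /(_ fin1 erefl) ae12.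
  move: aeuf ae12; apply: filterS2 => w uf [eq12 fin2] e e' Ee Ee' be be' ee' ce.
  have inj : set_inj (E w `&` [set e | Q2 w e]) (next_edge (E w)).
    by apply: (counting_surj (surj w uf) (esym eq12)); rewrite -/(number G Q1 w) eq12.
  apply: inj.
  - exact/mem_set/(conj Ee (conj be ce)).
  - by apply/mem_set; rewrite ee' in ce; exact: (conj Ee' (conj be' ce)).
  - have [En n1] := next_edgeP uf Ee; apply: (next_edgeE uf Ee' En).
    by rewrite n1.
have all : {ae P, forall w, forall k : int * int,
    let w' := theta (lattice_vector (- k.1) (- k.2)) w in
    forall e e', E w' e -> E w' e' ->
    backward_infinite (E w') e -> backward_infinite (E w') e' ->
    e.2 = e'.2 -> in_cell (0, 0) e.2 -> e = e'}.
  by apply: ae_all => k; exact: (ae_theta act (lattice_vector (- k.1) (- k.2)) base).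
apply: filterS all => w H e e' Ee Ee' be be' ee'.
pose k := (Num.floor e.2.1, Num.floor e.2.2).
apply: (@shift_inj R (lattice_vector (- k.1) (- k.2))); apply: (H k).
- exact/EE.
- exact/EE.
- exact/(backward_infinite_shift (EE _ _)).
- exact/(backward_infinite_shift (EE _ _)).
- by rewrite /shift /= ee'.
- by rewrite /shift /= -(in_cell_shift k (0, 0)) /= !addr0 lattice_vectorN addNKr.
Qed.

(** For the left side, the order of the line is reversed. *)
Lemma exits_unbounded (h : R) (Q : Omega -> edge R -> Prop) : edge_event Q ->
    (forall k w e, Q (theta (lattice_vector k 0) w) (shift (lattice_vector k 0) e) <->
                   Q w e) ->
  {ae P, forall w, [set e | E w e /\ Q w e] !=set0 ->
     unbounded_both (crossing_x h) [set e | E w e /\ Q w e]}.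
Proof.
move=> mQ Qs; have vh k : h = (lattice_vector k 0).2 + h by rewrite /= add0r.
have fs k e : Num.floor (crossing_x h (shift (lattice_vector k 0) e)) =
    Num.floor (crossing_x h e) + k.
  by rewrite {1}(vh k) crossing_x_shift floorDl addrC.
have mfl : forall k, edge_event (fun (_ : Omega) e => Num.floor (crossing_x h e) = k).
  by move=> k a ma; apply: event_floor; exact: measurable_crossing_x.
have up := unbounded_above mG act stat mQ mfl Qs fs.
have down : {ae P, forall w, (exists2 e, E w e & Q w e) ->
    forall k, exists2 e, E w e & Q w e /\ k <= - Num.floor (crossing_x h e)}.
  apply: (@unbounded_above _ _ _ P G theta mG act stat Q
    (fun e => - Num.floor (crossing_x h e)) (fun k => lattice_vector (- k) 0)) => //.
  - move=> k a ma.
    apply: (event_ext (S := fun w => Num.floor (crossing_x h (a w)) = - k)).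
      by move=> w; split => [->|<-]; rewrite opprK.
    exact: mfl.
  - by move=> k e; rewrite fs opprD opprK.
move: up down; apply: filterS2 => w up down [e0 [Ee0 Qe0]] M.
have ex : exists2 e, E w e & Q w e by exists e0.
split.
  have [e Ee [Qe ke]] := up ex (Num.floor M + 1); exists e => //.
  by apply: lt_le_trans (floorD1_gt M) _; rewrite -floor_ge_int.
have [e Ee [Qe ke]] := down ex (- Num.floor M + 1); exists e => //.
apply: lt_le_trans (floorD1_gt _) _; apply: le_trans (floor_le M).
rewrite ler_int; move: ke; move: (Num.floor (crossing_x h e)) (Num.floor M) => x y.
by lia.
Qed.

Lemma ae_recurrent_level : {ae P, forall w, forall h, recurrent_level (E w) h}.
Proof.
apply: ae_all => h; apply: exits_unbounded.
  by move=> a ma; exact: event_rightmost.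
move=> k w e; rewrite -(rightmost_shift (EE (lattice_vector k 0) w)).
by rewrite [(lattice_vector k 0).2]/= add0r.
Qed.

Lemma ae_backward_infinite_exits :
  {ae P, forall w, forall h, backward_infinite_exits (E w) h !=set0 ->
     unbounded_both (crossing_x h%:~R) (backward_infinite_exits (E w) h)}.
Proof.
apply: ae_all => h; apply: exits_unbounded.
  by move=> a ma; apply: event_and; [exact: event_exit_edge|exact: event_backward_infinite].
move=> k w e; rewrite -(exit_edge_shift (EE (lattice_vector k 0) w)).
rewrite -(backward_infinite_shift (EE (lattice_vector k 0) w)).
by rewrite [(lattice_vector k 0).2]/= add0r.
Qed.

(** Mass transport from the rightmost exit of a tree at height [a] to its rightmost exit
    at height [b]. A unit interval of the upper level receives at most one unit per
    rightmost exit in it, while the means are equal by vertical stationarity. The predicate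
    [Q] restricts the senders to those with a well-defined target, which is no restriction
    almost surely. *)
Lemma ae_rightmost_predecessor (a b : R) : b = 1 + a ->
  {ae P, forall w, upward_forest (E w)} ->
  {ae P, forall w, forall r, rightmost_exits (E w) a r ->
     exists2 r', rightmost_exits (E w) b r' & same_tree (E w) r r'} ->
  {ae P, forall w, forall r', rightmost_exits (E w) b r' ->
     exists2 r, rightmost_exits (E w) a r & same_tree (E w) r r'}.
Proof.
move=> ba aeuf aenext.
pose in_strip (x : R) (k : int) w e :=
  rightmost (E w) x e /\ Num.floor (crossing_x x e) = k.
pose L w r k := exists2 r', E w r' & in_strip b k w r' /\ same_tree (E w) r r'.
pose Q w r := rightmost (E w) a r /\ exists! k, L w r k.
pose F (w : Omega) (e : edge R) k := Num.floor (crossing_x a e) = k.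
have mS x k : edge_event (in_strip x k).
  move=> c mc; apply: event_and; first exact: event_rightmost.
  by apply: event_floor; exact: measurable_crossing_x.
have mL k : edge_event (fun w e => L w e k).
  move=> c mc; apply: (event_ex_edge mG) => c' mc'; apply: event_and.
    exact: mS.
  exact: event_same_tree.
have mQ : edge_event Q.
  move=> c mc; apply: event_and; first exact: event_rightmost.
  apply: event_ex => k; apply: event_and; first exact: mL.
  by apply: event_all => k'; apply: event_imp; [exact: mL|exact: event_cst].
have mF k : edge_event (fun w e => F w e k).
  by move=> c mc; apply: event_floor; exact: measurable_crossing_x.
have v0 k (x : R) : (lattice_vector k 0).2 + x = x by rewrite /= add0r.
have fl k (x : R) e : Num.floor (crossing_x x (shift (lattice_vector k 0) e)) =
    k + Num.floor (crossing_x x e).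
  by rewrite -{1}(v0 k x) crossing_x_shift floorDl.
have rs k w (x : R) e :
    rightmost (E (theta (lattice_vector k 0) w)) x (shift (lattice_vector k 0) e) <->
    rightmost (E w) x e.
  by rewrite -{1}(v0 k x); exact: (rightmost_shift (EE _ w)).
have Ls k w e l :
    L (theta (lattice_vector k 0) w) (shift (lattice_vector k 0) e) (k + l) <-> L w e l.
  rewrite /L /in_strip (ex_shift (EE (lattice_vector k 0) w)).
  split=> -[r' Er' [[Rr' fr] st]]; exists r' => //; move: Rr' st fr.
    by rewrite rs (same_tree_shift (EE _ w)) fl => ? ? /addrI.
  by rewrite rs (same_tree_shift (EE _ w)) fl => ? ? ->.
have Qs k w e :
    Q (theta (lattice_vector k 0) w) (shift (lattice_vector k 0) e) <-> Q w e.
  rewrite /Q rs; split=> -[re [l [Ll lu]]]; split => //.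
    exists (- k + l); split; first by rewrite -(Ls k) addNKr.
    by move=> l' /(Ls k) /lu ->; rewrite addKr.
  exists (k + l); split; first exact/Ls.
  by move=> l' Ll'; rewrite (lu (- k + l')) ?addNKr// -(Ls k) addNKr.
pose X w e := Q w e /\ F w e 0.
pose Y w e := Q w e /\ L w e 0.
have transport : mean P G X = mean P G Y.
  apply: (@mass_transport _ _ _ P G theta mG act stat int 0 -%R
    (fun k => lattice_vector k 0) (@opprK _) Q F L mQ mF mL) => //.
  - by move=> w e _ _; exists (Num.floor (crossing_x a e)).
  - by move=> w e _ [].
  - by move=> k w e; rewrite /F fl; split; lia.
  - by move=> k w e; have := Ls k w e 0; rewrite addr0.
have mean_ab : mean P G (in_strip a 0) = mean P G (in_strip b 0).
  rewrite -(mean_theta mG act stat (0, 1) (mS b 0)); apply: mean_ext => w e _.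
  have {}ba : b = ((0, 1) : plane R).2 + a by [].
  rewrite /in_strip ba (rightmost_shift (EE _ w)) crossing_x_shift.
  by rewrite [((0, 1) : plane R).1]/= add0r.
have fin_a : (mean P G (in_strip a 0%R) < +oo)%E.
  apply: le_lt_trans (mean_crosses_fin a); apply: le_integral_ge0 => w.
    exact: number_ge0.
  apply: le_counting => e [Ee [[[ea xe] _] fe]]; split; first exact: Ee.
  by split; [rewrite /crossing ea; exact: (xe 0%N)|exact: fe].
have mean_Q : mean P G (in_strip a 0) = mean P G X.
  have mX : edge_event X.
    by move=> c mc; apply: event_and; [exact: mQ|exact: mF].
  apply: ge0_ae_eq_integral; [exact: measurableT|exact: measurable_number|
    exact: measurable_number|by move=> w _; exact: number_ge0|
    by move=> w _; exact: number_ge0|].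
  move: aeuf aenext; apply: filterS2 => w uf next _.
  rewrite /number; congr counting; apply/seteqP.
  split=> e [Ee]; last first.
    move=> [[re _] fe]; split; [exact: Ee|exact: (conj re fe)].
  move=> [re fe]; split; first exact: Ee.
  split; last exact: fe.
  split; first exact: re.
  have [r' [Er' Rr'] er'] := next e (conj Ee re).
  exists (Num.floor (crossing_x b r')); split.
    exact: (ex_intro2 _ _ r' Er' (conj (conj Rr' erefl) er')).
  move=> k [r2 Er2 [[Rr2 <-] er2]].
  have st : same_tree (E w) r' r2.
    apply: (same_tree_trans uf Er' Ee Er2) er2; exact: same_tree_sym er'.
  by rewrite (rightmost_unique uf (conj Er' Rr') (conj Er2 Rr2) st).
have mY : edge_event Y.
  by move=> c mc; apply: event_and; [exact: mQ|exact: mL].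
have mean_Y : mean P G Y = mean P G (in_strip b 0).
  exact: etrans (esym transport) (etrans (esym mean_Q) mean_ab).
pose hit w : set (edge R) := [set r' | (E w r' /\ in_strip b 0 w r') /\
   exists2 r, rightmost_exits (E w) a r & same_tree (E w) r r'].
have le_hit w : upward_forest (E w) -> (number G Y w <= counting (hit w))%E.
  move=> uf; pose g r := xget r [set r' | E w r' /\
    (in_strip b 0 w r' /\ same_tree (E w) r r')].
  have gP r : (E w `&` [set e | Y w e]) r ->
      E w (g r) /\ (in_strip b 0 w (g r) /\ same_tree (E w) r (g r)).
    move=> [Er [_ [r' Er' H]]]; rewrite /g; case: xgetP => [y _ //|/(_ r')[]].
    by split.
  apply: (@counting_inj _ _ _ _ _ g).
    move=> r1 r2 /set_mem Y1 /set_mem Y2 g12.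
    have [Eg1 [_ s1]] := gP _ Y1; have [Eg2 [_ s2]] := gP _ Y2.
    have [Er1 [[R1 _] _]] := Y1; have [Er2 [[R2 _] _]] := Y2.
    apply: (rightmost_unique uf (conj Er1 R1) (conj Er2 R2)).
    apply: (same_tree_trans uf Er1 Eg1 Er2 s1).
    by rewrite g12; exact: same_tree_sym.
  move=> _ [r Yr <-]; have [Eg [Rg sg]] := gP _ Yr.
  by split; [split|exists r; [case: Yr => Er [[Rr _] _]; split|]].
have hit_sub w : hit w `<=` E w `&` [set e | in_strip b 0 w e] by move=> e [].
have base : {ae P, forall w, forall r', E w r' -> in_strip b 0 w r' ->
    exists2 r, rightmost_exits (E w) a r & same_tree (E w) r r'}.
  have le : {ae P, forall w, number G Y w <= number G (in_strip b 0%R) w}%E.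
    apply: filterS aeuf => w uf; apply: le_trans (le_hit w uf) _.
    exact: le_counting.
  have := @ae_eq_of_le _ Omega R P _ _ (measurable_number mG mY)
    (measurable_number mG (mS b 0)) (number_ge0 G Y) (number_ge0 G (in_strip b 0)) le.
  rewrite -/(mean P G Y) -/(mean P G (in_strip b 0)) -mean_ab => /(_ fin_a).
  rewrite mean_ab => /(_ mean_Y).
  move: aeuf; apply: filterS2 => w uf [eqY fin] r' Er' Sr'.
  have e : hit w = E w `&` [set e | in_strip b 0 w e].
    apply: (@subset_counting_eq R _ _ _ (hit_sub w) _ fin).
    apply/le_anti/andP; split; first exact: (le_counting _ (hit_sub w)).
    by rewrite -/(number G (in_strip b 0) w) -eqY; exact: (le_hit w uf).
  suff /proj2 : hit w r' by exact.
  by rewrite e; exact: (conj Er' Sr').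
have all : {ae P, forall w, forall k : int,
    let w' := theta (lattice_vector (- k) 0) w in
    forall r', E w' r' -> in_strip b 0 w' r' ->
    exists2 r, rightmost_exits (E w') a r & same_tree (E w') r r'}.
  by apply: ae_all => k; exact: (ae_theta act (lattice_vector (- k) 0) base).
apply: filterS all => w H r' [Er' Rr'].
pose k := Num.floor (crossing_x b r').
have [||r] := H k (shift (lattice_vector (- k) 0) r').
- exact/EE.
- by split; [exact/rs|rewrite fl addNr].
move=> [Er Rr] st; move: Er Rr st.
rewrite -(shiftK (lattice_vector (- k) 0) r); set s' := shift (- _) r.
rewrite EE rs (same_tree_shift (EE _ w)) => Es Rs st.
exact: (ex_intro2 _ _ s' (conj Es Rs) st).
Qed.

Definition several_trees w : Prop :=
  exists2 e, E w e & exists2 e', E w e' & ~ same_tree (E w) e e'.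

Lemma event_several_trees : event several_trees.
Proof.
apply: (event_ex_edge mG) => a ma; apply: (event_ex_edge mG) => b mb.
by apply: event_not; exact: event_same_tree.
Qed.

(** The event is invariant under all translations. *)
Lemma several_trees_01 : P [set w | several_trees w] = 0%E \/
  P [set w | several_trees w] = 1%E.
Proof.
apply: (action_ergodic act event_several_trees) => s; apply/seteqP.
split=> w /=; rewrite /several_trees (ex_shift (EE s w)) => -[e Ee].
  rewrite (ex_shift (EE s w)) => -[e' Ee'].
  by rewrite (same_tree_shift (EE s w)); exists e => //; exists e'.
move=> [e' Ee' nee']; exists e => //; rewrite (ex_shift (EE s w)); exists e' => //.
by rewrite (same_tree_shift (EE s w)).
Qed.

Lemma ae_one_ended :
    P [set w | several_trees w] = 0%E ->
    {ae P, forall w, upward_forest (E w)} ->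
  {ae P, forall w, (forall e e', E w e -> E w e' -> same_tree (E w) e e') /\
                   (forall e, E w e -> ~ backward_infinite (E w) e)}.
Proof.
move=> PS aeuf.
have aeone : {ae P, forall w, ~ several_trees w}.
  exists [set w | several_trees w]; split; [exact: event_several_trees|exact: PS|].
  by move=> w /= /contrapT.
have aeinj := ae_backward_infinite_unique aeuf.
have aeuf_inj : {ae P, forall w, upward_forest (E w) /\
    forall e e', E w e -> E w e' -> backward_infinite (E w) e ->
      backward_infinite (E w) e' -> e.2 = e'.2 -> e = e'}.
  by move: aeuf aeinj; apply: filterS2.
have aeb := ae_backward_infinite_exits.
move: aeuf_inj aeone aeb; apply: filterS3 => w [uf inj] ns unb.
have one e e' : E w e -> E w e' -> same_tree (E w) e e'.
  by move=> Ee Ee'; apply: contrapT => ne; apply: ns; exists e => //; exists e'.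
by split=> //; exact: (no_backward_infinite uf).
Qed.

Lemma ae_many_two_ended :
    P [set w | several_trees w] = 1%E ->
    {ae P, forall w, upward_forest (E w)} ->
  {ae P, forall w,
    (exists S : set (edge R), [/\ infinite_set S, S `<=` E w &
       forall e e', S e -> S e' -> same_tree (E w) e e' -> e = e']) /\
    forall e, E w e -> exists2 b, E w b &
      same_tree (E w) e b /\ backward_infinite (E w) b}.
Proof.
move=> PS aeuf.
have aemany : {ae P, forall w, several_trees w}.
  exists (~` [set w | several_trees w]); split=> //.
    exact/measurableC/event_several_trees.
  by rewrite probability_setC ?PS ?subee//; exact: event_several_trees.
have aenext : {ae P, forall w, forall h : int, forall r,
    rightmost_exits (E w) h%:~R r ->
    exists2 r', rightmost_exits (E w) (h + 1)%:~R r' & same_tree (E w) r r'}.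
  move: aeuf ae_crossing_finite ae_recurrent_level; apply: filterS3.
  by move=> w uf cf rec h r; exact: rightmost_next.
have aeprev : {ae P, forall w, forall h : int, forall r',
    rightmost_exits (E w) (h + 1)%:~R r' ->
    exists2 r, rightmost_exits (E w) h%:~R r & same_tree (E w) r r'}.
  apply: ae_all => h; apply: ae_rightmost_predecessor aeuf _.
    by rewrite addrC intrD.
  by apply: filterS aenext => w; exact.
have aecf := ae_crossing_finite; have aerec := ae_recurrent_level.
have aeufcf : {ae P, forall w, upward_forest (E w) /\ crossing_finite (E w)}.
  by move: aeuf aecf; apply: filterS2.
have aetrees : {ae P, forall w, several_trees w /\ forall h, recurrent_level (E w) h}.
  by move: aemany aerec; apply: filterS2.
move: aeufcf aetrees aeprev.
apply: filterS3 => w [uf cf] [[e1 E1 [e2 E2 n12]] rec] prev.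
have other e : E w e -> exists2 e', E w e' & ~ same_tree (E w) e e'.
  move=> Ee; have [s1|] := pselect (same_tree (E w) e e1); last by exists e1.
  exists e2 => // s2; apply: n12; apply: (same_tree_trans uf E1 Ee E2) => //.
  exact: same_tree_sym.
have tb e (Ee : E w e) := tree_backward_infinite uf cf Ee rec prev (other e Ee).
split; last by move=> e /tb[].
have [_ [h R0]] := tb e1 E1; exists (rightmost_exits (E w) h%:~R); split.
- exact: unbounded_infinite (rec h R0).
- by move=> e [].
- by move=> e e'; exact: rightmost_unique.
Qed.

End stationary_forest.

Theorem theorem2 (R : realType) (d : measure_display) (Omega : measurableType d)
    (P : probability Omega R) (G : Omega -> geograph R)
    (forestG : random_geometric_forest P G)
    (planarG : {ae P, forall w, planar (G w)})
    (stationaryG : stationary_ergodic P G)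
    (intensityG : (edge_intensity P G < +oo)%E)
    (directedG : {ae P, forall w, [/\ vertices (G w) !=set0, oriented (G w),
                                      outdegree_one (G w)
                                    & directed_upwards (G w)]}) :
  ({ae P, forall w, single_one_ended_tree (G w)} /\
   ~ {ae P, forall w, infinitely_many_two_ended_trees (G w)}) \/
  ({ae P, forall w, infinitely_many_two_ended_trees (G w)} /\
   ~ {ae P, forall w, single_one_ended_tree (G w)}).
Proof.
have [mG aeF] := forestG; have [theta [act stat]] := stationaryG.
have excl : ~ ({ae P, forall w, single_one_ended_tree (G w)} /\
    {ae P, forall w, infinitely_many_two_ended_trees (G w)}).
  move=> [ae1 ae2]; apply: (@ae_false _ _ _ P); move: ae1 ae2; apply: filterS2.
  by move=> w [C [CE _ _]] [inf _]; apply: inf; rewrite CE; exact: finite_set1.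
suff [one|many] : {ae P, forall w, single_one_ended_tree (G w)} \/
    {ae P, forall w, infinitely_many_two_ended_trees (G w)}.
- by left; split=> // many; exact: excl.
- by right; split=> // one; exact: excl.
have good : {ae P, forall w, [/\ acyclic (G w), finite_degrees (G w), planar (G w),
    vertices (G w) !=set0 & outdegree_one (G w) /\ directed_upwards (G w)]}.
  by move: aeF planarG directedG; apply: filterS3 => w [? ?] ? [].
have aeuf : {ae P, forall w, upward_forest (edges (G w))}.
  by apply: filterS good => w [? ? ? ? []]; exact: upward_forest_edges.
case: (several_trees_01 mG act stat) => PS; [left|right].
- have := ae_one_ended mG act stat intensityG PS aeuf.
  move: good; apply: filterS2 => w [ac fd pl ne [od du]] [one nb].
  exact: single_tree.
- have := ae_many_two_ended mG act stat intensityG PS aeuf.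
  have := ae_backward_infinite_unique mG act stat intensityG aeuf.
  move: good; apply: filterS3.
  move=> w [ac fd pl ne [od du]] inj [[S [Si SE Sinj]] tb].
  exact: many_trees Si SE Sinj inj tb.
Qed.
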